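(* For $S$-hyperbolic polynomials $q$ of degree $n$ in $n$ variables, Problem 1 and Problem 2 are equivalent, i.e. $(1,\dots,1)\in\mathrm{supp}(q)$ if and only if $(1,\dots,1)\in\mathrm{CO}(\mathrm{supp}(q))$. Moreover, there exists a deterministic polynomial-time oracle algorithm which, given an $S$-hyperbolic polynomial $q(\alpha_1,\dots,\alpha_n)$ with nonnegative integer coefficients as an evaluation oracle, solves Problem 1; it uses $O\big(n^4(\ln n+\ln\ln q(1,\dots,1))\big)$ oracle calls, and its bit-wise complexity (the size of the points at which the oracle is queried) is $O\big(n^{1/2}\ln q(1,\dots,1)\big)$.
   Context: For a homogeneous polynomial $q(x)=\sum_r a_r\prod_i x_i^{r_i}$ of degree $n$ in $n$ variables ($r$ ranging over nonnegative integer vectors summing to $n$), $\mathrm{supp}(q)=\{r:a_r\neq0\}$ and $\mathrm{CO}$ denotes convex hull. Problem 1: given $q$ with nonnegative integer coefficients as a black box (evaluation oracle), decide whether $(1,\dots,1)\in\mathrm{supp}(q)$, i.e. whether $\frac{\partial^n}{\partial x_1\cdots\partial x_n}q\ne0$. Problem 2: decide whether $(1,\dots,1)\in\mathrm{CO}(\mathrm{supp}(q))$. A deterministic polynomial-time oracle algorithm evaluates $q$ at a number of rational vectors polynomial in $n$ and $\log q(1,\dots,1)$, these vectors having bit size polynomial in $n$ and $\log q(1,\dots,1)$, and performs polynomially many additional arithmetic steps. A homogeneous polynomial $p$ of degree $n$ in $n$ real variables is $P$-hyperbolic if for every $x\in\mathbb{R}^n$, $\lambda\mapsto p(x-\lambda(1,\dots,1))$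 has exactly $n$ real roots (with multiplicity), $p(1,\dots,1)>0$, and for each standard basis vector $e_i$ all roots of $p(e_i-\lambda(1,\dots,1))$ are nonnegative. $q$ (with nonnegative coefficients) is $S$-hyperbolic if some $P$-hyperbolic $p$ has $\mathrm{supp}(p)=\mathrm{supp}(q)$. *)

(* Defs.v *)
From HB Require Import structures.
From mathcomp Require Import all_boot all_order all_algebra.
From mathcomp Require Import mpoly reals.
(* [exp] is not imported: the notations of the analysis library clash with
   those of [mpoly]. *)
From mathcomp Require exp.

Set Implicit Arguments.
Unset Strict Implicit.
Unset Printing Implicit Defensive.

Import Order.TTheory GRing.Theory Num.Theory.

Local Open Scope ring_scope.

(** * Hyperbolic polynomials *)

Section Hyperbolic.
Context {R : realType} {n : nat}.

(* The univariate polynomial l |-> p (x - l (1, ..., 1)). *)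
Definition line_poly (p : {mpoly R[n]}) (x : 'I_n -> R) : {poly R} :=
  mmap (@polyC R) (fun i => (x i)%:P - 'X) p.

(* [s] lists the real roots of [P], each repeated according to its
   multiplicity. *)
Definition root_list (P : {poly R}) (s : seq R) : Prop :=
  P != 0 /\ forall a : R, count_mem a s = mup a P.

Definition std_basis (i : 'I_n) : 'I_n -> R := fun j => (j == i)%:R.

Definition P_hyperbolic (p : {mpoly R[n]}) : Prop :=
  [/\ p \is n.-homog,
      forall x : 'I_n -> R, exists2 s, root_list (line_poly p x) s & size s = n,
      0 < p.@[fun=> 1]
    & forall (i : 'I_n) (l : R), root (line_poly p (std_basis i)) l -> 0 <= l].

Definition S_hyperbolic (q : {mpoly R[n]}) : Prop :=
  [/\ q \is n.-homog,
      forall m : 'X_{1..n}, 0 <= q@_m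
    & exists2 p : {mpoly R[n]}, P_hyperbolic p & msupp p =i msupp q].

(* x is in the convex hull of the finite set of exponent vectors listed,
   without repetition, by [s]. *)
Definition in_CO (s : seq 'X_{1..n}) (x : 'I_n -> R) : Prop :=
  exists w : 'X_{1..n} -> R,
    [/\ {in s, forall r, 0 <= w r},
        \sum_(r <- s) w r = 1
      & forall i, \sum_(r <- s) w r * (r i)%:R = x i].

End Hyperbolic.

Definition ones (n : nat) : 'X_{1..n} := [multinom 1%N | i < n].

Definition problem1 (A : nzRingType) (n : nat) (q : {mpoly A[n]}) : Prop :=
  ones n \in msupp q.

Definition problem2 (R : realType) (n : nat) (q : {mpoly R[n]}) : Prop :=
  in_CO (msupp q) (fun=> 1 : R).

(** * Oracle algorithms

   A program is run on a RAM with two kinds of registers: index registers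
   holding natural numbers, and cells holding rational numbers, which can be
   addressed indirectly through index expressions.  There is no rounding
   operation, and no access to the digits, the numerator or the denominator of
   a rational.  One finite program serves all dimensions n. *)

Inductive iexp : Type :=
| IConst of nat
| IReg of nat
| IAdd of iexp & iexp
| ISub of iexp & iexp
| IMul of iexp & iexp.

Inductive qexp : Type :=
| QConst of rat
| QCell of iexp
| QNat of iexp
| QAdd of qexp & qexp
| QSub of qexp & qexp
| QMul of qexp & qexp
| QDiv of qexp & qexp.

Inductive test : Type :=
| TIle of iexp & iexp
| TQle of qexp & qexp
| TNot of test.

Inductive com : Type :=
| Skip
| ISet of nat & iexp
| QSet of iexp & qexp
| Query of iexp & iexp
| Seq of com & com
| If of test & com & com
| While of test & com.

Record state : Type := State { ireg : nat -> nat; cell : nat -> rat }.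

Definition set_ireg (s : state) (k v : nat) : state :=
  State [eta ireg s with k |-> v] (cell s).

Definition set_cell (s : state) (k : nat) (v : rat) : state :=
  State (ireg s) [eta cell s with k |-> v].

Fixpoint ieval (s : state) (e : iexp) : nat :=
  match e with
  | IConst k => k
  | IReg k => ireg s k
  | IAdd a b => (ieval s a + ieval s b)%N
  | ISub a b => (ieval s a - ieval s b)%N
  | IMul a b => (ieval s a * ieval s b)%N
  end.

(* Division by 0 returns 0. *)
Fixpoint qeval (s : state) (e : qexp) : rat :=
  match e with
  | QConst c => c
  | QCell a => cell s (ieval s a)
  | QNat a => (ieval s a)%:R
  | QAdd a b => qeval s a + qeval s b
  | QSub a b => qeval s a - qeval s b
  | QMul a b => qeval s a * qeval s b
  | QDiv a b => qeval s a / qeval s b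
  end.

Fixpoint teval (s : state) (t : test) : bool :=
  match t with
  | TIle a b => (ieval s a <= ieval s b)%N
  | TQle a b => qeval s a <= qeval s b
  | TNot u => ~~ teval s u
  end.

(* The cost of evaluating an expression is its number of nodes. *)
Fixpoint icost (e : iexp) : nat :=
  match e with
  | IConst _ | IReg _ => 1
  | IAdd a b | ISub a b | IMul a b => (icost a + icost b).+1
  end.

Fixpoint qcost (e : qexp) : nat :=
  match e with
  | QConst _ => 1
  | QCell a | QNat a => (icost a).+1
  | QAdd a b | QSub a b | QMul a b | QDiv a b => (qcost a + qcost b).+1
  end.

Fixpoint tcost (t : test) : nat :=
  match t with
  | TIle a b => (icost a + icost b).+1
  | TQle a b => (qcost a + qcost b).+1
  | TNot u => (tcost u).+1
  end.

(* [exec f c s s' vs t]: with oracle [f], the program [c] started in state [s]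
   halts in state [s'] after [t] steps, having queried [f] at the successive
   vectors [vs].  [Query d a] reads the query vector in the n consecutive cells
   starting at address [a] and writes the answer at address [d]. *)
Inductive exec (n : nat) (f : {ffun 'I_n -> rat} -> rat) :
  com -> state -> state -> seq {ffun 'I_n -> rat} -> nat -> Prop :=
| ExecSkip s : exec f Skip s s [::] 1
| ExecISet s k e :
    exec f (ISet k e) s (set_ireg s k (ieval s e)) [::] (icost e).+1
| ExecQSet s a e :
    exec f (QSet a e) s (set_cell s (ieval s a) (qeval s e)) [::]
      (icost a + qcost e).+1
| ExecQuery s d a :
    let v := [ffun i : 'I_n => cell s (ieval s a + i)%N] in
    exec f (Query d a) s (set_cell s (ieval s d) (f v)) [:: v]
      (icost d + icost a).+1
| ExecSeq c1 c2 s s1 s2 vs1 vs2 t1 t2 :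
    exec f c1 s s1 vs1 t1 -> exec f c2 s1 s2 vs2 t2 ->
    exec f (Seq c1 c2) s s2 (vs1 ++ vs2) (t1 + t2)
| ExecIf b c1 c2 s s1 vs t :
    exec f (if teval s b then c1 else c2) s s1 vs t ->
    exec f (If b c1 c2) s s1 vs (tcost b + t).+1
| ExecWhileStop b c s :
    ~~ teval s b -> exec f (While b c) s s [::] (tcost b).+1
| ExecWhileLoop b c s s1 s2 vs1 vs2 t1 t2 :
    teval s b -> exec f c s s1 vs1 t1 ->
    exec f (While b c) s1 s2 vs2 t2 ->
    exec f (While b c) s s2 (vs1 ++ vs2) (tcost b + t1 + t2).+1.

Lemma exec_det n f c s s1 s2 vs1 vs2 t1 t2 :
  @exec n f c s s1 vs1 t1 -> exec f c s s2 vs2 t2 ->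
  [/\ s1 = s2, vs1 = vs2 & t1 = t2].
Proof.
move=> h; elim: h s2 vs2 t2 => {c s s1 vs1 t1}.
- by move=> s s2 vs t h; inversion h.
- by move=> s k e s2 vs t h; inversion h.
- by move=> s a e s2 vs t h; inversion h.
- by move=> s d a v s2 vs t h; inversion h.
- move=> c1 c2 s s1 s1' us1 us2 u1 u2 _ IH1 _ IH2 s2 vs t h.
  inversion h as [| | | |? ? ? r ? ? ? ? ? h1 h2| | |]; subst.
  by case: (IH1 _ _ _ h1) h2 => <- <- <- /IH2 [-> -> ->].
- move=> b c1 c2 s s1 us u _ IH s2 vs t h.
  inversion h as [| | | | |? ? ? ? ? ? ? h1| |]; subst.
  by case: (IH _ _ _ h1) => -> -> ->.
- move=> b c s nb s2 vs t h.
  inversion h as [| | | | | | |? ? ? r ? ? ? ? ? hb h1 h2]; subst => //.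
  by rewrite hb in nb.
- move=> b c s s1 s1' us1 us2 u1 u2 hb _ IH1 _ IH2 s2 vs t h.
  inversion h as [| | | | | |? ? ? nb|? ? ? r ? ? ? ? ? _ h1 h2]; subst.
    by rewrite hb in nb.
  by case: (IH1 _ _ _ h1) h2 => <- <- <- /IH2 [-> -> ->].
Qed.

Definition oracle (n : nat) (q : {mpoly int[n]}) (v : {ffun 'I_n -> rat}) : rat :=
  (map_mpoly (intr : int -> rat) q).@[v].

(* The program only receives the dimension, in index register 0; everything
   else is initially 0. *)
Definition init_state (n : nat) : state :=
  State [eta (fun=> 0%N) with 0%N |-> n] (fun=> 0).

(* The answer is read in index register 0: 1 for yes, 0 for no. *)
Definition runs (c : com) (n : nat) (q : {mpoly int[n]})
    (answer : bool) (vs : seq {ffun 'I_n -> rat}) (t : nat) : Prop :=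
  exists2 s : state,
    exec (oracle q) c (init_state n) s vs t & ireg s 0 = answer :> nat.

(* [up_log 2 k.+1] is the number of binary digits of [k]; the last summand
   stands for the sign. *)
Definition bit_size (x : rat) : nat :=
  (up_log 2 `|numq x|.+1 + up_log 2 `|denq x|.+1 + 1)%N.

(* Maximum, not sum, over the coordinates: the sum is at least n, hence never
   O(sqrt n * ln q(1, ..., 1)) when q(1, ..., 1) stays bounded. *)
Definition vec_bit_size (n : nat) (v : {ffun 'I_n -> rat}) : nat :=
  \max_(i < n) bit_size (v i).

Section Algorithms.
Context (R : realType).

(* Inputs: nonnegativity of the integer coefficients is part of
   [S_hyperbolic]. *)
Definition S_hyperbolic_int (n : nat) (q : {mpoly int[n]}) : Prop :=
  S_hyperbolic (map_mpoly (intr : int -> R) q).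

Definition at_ones (n : nat) (q : {mpoly int[n]}) : R := (q.@[fun=> 1])%:~R.

Definition solves_problem1 (c : com) : Prop :=
  forall (n : nat) (q : {mpoly int[n]}), S_hyperbolic_int q ->
    exists (answer : bool) (vs : seq {ffun 'I_n -> rat}) (t : nat),
      runs c q answer vs t /\ (answer <-> problem1 q).

(* A quantity is polynomial in n and ln q(1, ..., 1) when it is at most
   [a * (1 + n + ln q(1, ..., 1)) ^ k] for some constants [a] and [k]. *)
Definition poly_time (c : com) : Prop :=
  exists a k : nat, forall (n : nat) (q : {mpoly int[n]}), S_hyperbolic_int q ->
    let B : R := a%:R * (1 + n%:R + exp.ln (at_ones q)) ^+ k in
    exists (answer : bool) (vs : seq {ffun 'I_n -> rat}) (t : nat),
      [/\ runs c q answer vs t,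
          (size vs)%:R <= B,
          {in vs, forall v, (vec_bit_size v)%:R <= B}
        & t%:R <= B].

(* The bound is required wherever ln ln q(1, ..., 1) makes sense and the
   right-hand side is positive: this leaves out q(1, ..., 1) = 1 and the case
   n = 1, q(1, ..., 1) = 2. *)
Definition query_count_bound (c : com) : Prop :=
  exists K : R, forall (n : nat) (q : {mpoly int[n]}), S_hyperbolic_int q ->
    (0 < n)%N -> 1 < at_ones q ->
    0 < exp.ln n%:R + exp.ln (exp.ln (at_ones q)) ->
    forall answer vs t, runs c q answer vs t ->
      (size vs)%:R
        <= K * (n%:R ^+ 4 * (exp.ln n%:R + exp.ln (exp.ln (at_ones q)))).

(* As above, [1 < at_ones q] makes the right-hand side positive. *)
Definition query_size_bound (c : com) : Prop :=
  exists K : R, forall (n : nat) (q : {mpoly int[n]}), S_hyperbolic_int q ->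
    (0 < n)%N -> 1 < at_ones q ->
    forall answer vs t, runs c q answer vs t ->
      {in vs, forall v,
        (vec_bit_size v)%:R <= K * (Num.sqrt n%:R * exp.ln (at_ones q))}.

End Algorithms.

(* Main.v *)
(* A P-hyperbolic polynomial p is real stable (Garding): p(x + i y) <> 0 for
   y > 0.  Hence p has nonnegative coefficients, its derivatives are stable, and
   its restrictions to nonnegative directions are real-rooted.  Comparing the
   coefficients of such restrictions shows that the support J of p has an
   exchange property, from which the rank function r(S) = max over m in J of
   m(S) is submodular, and (1, ..., 1) lies in J as soon as r(S) >= |S| for all
   S.  Both Problem 1 and Problem 2 are equivalent to the latter condition.

   The rank r(S) is read off one oracle call: with t = q(1, ..., 1) + 1, the
   value of q at t on S and 1 off S lies between t^r(S) and t^(r(S)+1).  The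
   greedy algorithm thus minimizes a linear form over the base polytope of r with
   n calls, and the perceptron algorithm decides whether (1, ..., 1) belongs to
   it: if r(S) < |S| for some S, the margin 1 / sqrt |S| and the diameter n bound
   the number of rounds by n^3.  This makes O(n^4) calls, at points whose
   coordinates are 1 or t. *)
Require Import Defs.
From mathcomp Require Import all_boot all_order all_algebra.
From mathcomp Require Import mpoly reals.
From mathcomp Require Import complex.
From mathcomp Require exp.
From mathcomp Require Import ring lra zify.

Set Implicit Arguments.
Unset Strict Implicit.
Unset Printing Implicit Defensive.

Import Order.TTheory GRing.Theory Num.Theory.

Local Open Scope ring_scope.

(** Non-vanishing on a product of half-planes is not closed under limits, yet limits occur whenever
    a derivative or a restriction to the boundary is formed. The growth of the modulus along
    vertical directions ([im_mono]) is a weak inequality: it passes to limits, and it gives back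
    non-vanishing for nonzero homogeneous polynomials. This stands in for Hurwitz's theorem. The
    exchange property rests on the bound e_N <= e_1 ^ N for elementary symmetric functions of
    nonnegative numbers; comparing exponents of a large parameter turns it into a chord inequality
    between weights. On the algorithmic side, the perceptron keeps exact integer weights, so that no
    rounding is wanted, and its number of rounds depends on n alone: the ranks are integers, hence a
    violated inequality r(S) >= |S| fails by at least 1. *)

Section HalfPlane.
Variable R : realType.
Local Notation C := R[i].
Local Notation "x %:C" := (real_complex R x) (format "x %:C").
Local Notation Re := (@complex.Re R).
Local Notation Im := (@complex.Im R).

Definition cabs (z : C) : R := Num.sqrt (Re z ^+ 2 + Im z ^+ 2).

Lemma normE (z : C) : `|z| = (cabs z)%:C.
Proof. exact: normc_def. Qed.

Lemma cabs_ge0 z : 0 <= cabs z.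
Proof. exact: sqrtr_ge0. Qed.

Lemma cabsM z w : cabs (z * w) = cabs z * cabs w.
Proof. by apply: (@complexI R); rewrite -normE normrM !normE rmorphM. Qed.

Lemma cabsX z k : cabs (z ^+ k) = cabs z ^+ k.
Proof. by apply: (@complexI R); rewrite -normE normrX !normE rmorphXn. Qed.

Lemma ler_cabsD z w : cabs (z + w) <= cabs z + cabs w.
Proof. by rewrite -lecR rmorphD /= -!normE ler_normD. Qed.

Lemma cabs_distC z w : cabs (z - w) = cabs (w - z).
Proof. by apply: (@complexI R); rewrite -!normE distrC. Qed.

Lemma cabs_eq0 z : (cabs z == 0) = (z == 0).
Proof. by rewrite -(inj_eq (@complexI R)) -normE normr_eq0. Qed.

Lemma cabs0 : cabs 0 = 0. Proof. by apply/eqP; rewrite cabs_eq0. Qed.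

Lemma cabs_real (x : R) : cabs x%:C = `|x|.
Proof. by rewrite /cabs /= expr0n addr0 sqrtr_sqr. Qed.

Lemma cabs_prod (I : Type) (r : seq I) (F : I -> C) :
  cabs (\prod_(i <- r) F i) = \prod_(i <- r) cabs (F i).
Proof.
apply: (big_morph cabs cabsM).
by rewrite -[1]/(1%:C) cabs_real normr1.
Qed.

Lemma ler_cabs_sum (I : Type) (r : seq I) (F : I -> C) :
  cabs (\sum_(i <- r) F i) <= \sum_(i <- r) cabs (F i).
Proof.
elim: r => [|x r IH]; first by rewrite !big_nil cabs0.
by rewrite !big_cons (le_trans (ler_cabsD _ _)) // lerD2l.
Qed.

Lemma ler_Im_cabs z : `|Im z| <= cabs z.
Proof.
rewrite -ler_sqr ?nnegrE ?cabs_ge0 // sqr_sqrtr ?addr_ge0 ?sqr_ge0 //.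
by rewrite real_normK ?num_real // lerDr sqr_ge0.
Qed.

Lemma cabs_mono z w : Re z = Re w -> 0 <= Im z <= Im w -> cabs z <= cabs w.
Proof.
by move=> e h; rewrite /cabs ler_wsqrtr // e lerD2l ler_sqr ?nnegrE; lra.
Qed.

Lemma ImD (z w : C) : Im (z + w) = Im z + Im w.
Proof. by case: z w => [a b] [c d]. Qed.
Lemma ReD (z w : C) : Re (z + w) = Re z + Re w.
Proof. by case: z w => [a b] [c d]. Qed.
Lemma ImN (z : C) : Im (- z) = - Im z.
Proof. by case: z. Qed.
Lemma ImZ (x : R) z : Im (x%:C * z) = x * Im z.
Proof. by case: z => a b /=; ring. Qed.
Lemma ReZ (x : R) z : Re (x%:C * z) = x * Re z.
Proof. by case: z => a b /=; ring. Qed.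

Lemma Im_sum (I : Type) (r : seq I) (F : I -> C) :
  Im (\sum_(i <- r) F i) = \sum_(i <- r) Im (F i).
Proof. by apply: (big_morph Im ImD). Qed.

Lemma Im_inv_lt0 z : 0 < Im z -> Im z^-1 < 0.
Proof.
case: z => a b /= b0; rewrite oppr_lt0 divr_gt0 //.
by rewrite ltr_wpDl ?sqr_ge0 // exprn_gt0.
Qed.

(** * Univariate polynomials without zeros in the upper half-plane *)

Definition uhp (P : {poly C}) := forall w, 0 < Im w -> P.[w] != 0.

Lemma uhp_neq0 P : uhp P -> P != 0.
Proof.
move=> h; apply/eqP => P0.
by have := h 'i%C (@ltr01 R); rewrite P0 horner0 eqxx.
Qed.

Lemma uhp_factor P : uhp P -> exists2 r : seq C,
  P = lead_coef P *: \prod_(a <- r) ('X - a%:P) & {in r, forall a, Im a <= 0}.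
Proof.
move=> h; have [r Pr] := closed_field_poly_normal P.
exists r => // a ar; rewrite leNgt; apply/negP => /h.
by rewrite Pr hornerZ horner_prod (big_rem a) //= hornerXsubC subrr mul0r mulr0 eqxx.
Qed.

(** All roots lie in the closed lower half-plane, so moving upwards increases the distance to each
    of them. *)
Lemma uhp_cabs_mono P z w : uhp P ->
  Re z = Re w -> 0 <= Im z <= Im w -> cabs P.[z] <= cabs P.[w].
Proof.
move=> /uhp_factor[r -> rP] eR eI.
rewrite !hornerZ !cabsM ler_wpM2l ?cabs_ge0 // !horner_prod !cabs_prod.
rewrite big_seq [leRHS]big_seq; apply: ler_prod => a /rP a0.
rewrite cabs_ge0 !hornerXsubC cabs_mono //; first by rewrite !ReD eR.
by rewrite !ImD !ImN; lra.
Qed.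

Lemma deriv_prod_XsubC (r : seq C) w : {in r, forall a, w != a} ->
  (\prod_(a <- r) ('X - a%:P))^`().[w] =
  (\prod_(a <- r) ('X - a%:P)).[w] * \sum_(a <- r) (w - a)^-1.
Proof.
elim: r => [|a r IH] h; first by rewrite !big_nil derivC horner0 mulr0.
rewrite !big_cons derivM derivXsubC mul1r hornerD !hornerM hornerXsubC.
rewrite IH => [|b br]; last by apply: h; rewrite inE br orbT.
have wa : w - a != 0 by rewrite subr_eq0 h // inE eqxx.
by field.
Qed.

(** A half-plane version of Gauss-Lucas: the logarithmic derivative is a sum of terms of negative
    imaginary part, which adding the real [e] leaves unchanged. The side condition excludes a
    constant [P] with [e = 0]. *)
Lemma uhp_deriv_addZ P (e : R) : uhp P -> (1 < size P)%N || (e != 0) ->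
  uhp (P^`() + e%:C *: P).
Proof.
move=> hP; have P0 := uhp_neq0 hP.
have [r Pr rP] := uhp_factor hP; move=> se w w0.
have wr : {in r, forall a, w != a}.
  by move=> a /rP a0; apply: contraL w0 => /eqP ->; rewrite -leNgt.
have -> : (P^`() + e%:C *: P).[w] = P.[w] * (\sum_(a <- r) (w - a)^-1 + e%:C).
  rewrite hornerD hornerZ mulrDr [e%:C * _]mulrC; congr (_ + _).
  by rewrite Pr derivZ !hornerZ deriv_prod_XsubC // mulrA.
rewrite mulf_neq0 ?hP //.
case: r Pr rP wr => [|a r] Pr rP wr.
  rewrite big_nil add0r; move: se; rewrite Pr big_nil.
  rewrite size_scale ?lead_coef_eq0 // size_polyC oner_eq0 /=.
  by rewrite fmorph_eq0.
suff : Im (\sum_(i <- a :: r) (w - i)^-1 + e%:C) < 0.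
  by apply: contraTneq => ->; rewrite ltxx.
have wa0 b : b \in a :: r -> Im (w - b)^-1 < 0.
  by move=> /rP b0; rewrite Im_inv_lt0 // ImD ImN; lra.
rewrite ImD /= addr0 Im_sum big_cons ltr_wnDr ?wa0 ?inE ?eqxx //.
rewrite big_seq sumr_le0 // => b br; rewrite ltW // wa0 //.
by rewrite inE br orbT.
Qed.

Lemma uhp_deriv P : uhp P -> (1 < size P)%N -> uhp P^`().
Proof.
move=> hP sP; have := @uhp_deriv_addZ P 0 hP; rewrite sP => /(_ isT).
by rewrite scale0r addr0.
Qed.

Lemma poly_cont (P : {poly C}) (a : C) (e : R) : 0 < e ->
  exists2 d : R, 0 < d & forall x, cabs (x - a) <= d -> cabs (P.[x] - P.[a]) <= e.
Proof.
elim/poly_ind: P e => [|P c IH] e e0.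
  by exists 1 => // x _; rewrite !horner0 subrr cabs0 ltW.
pose M := cabs P.[a] + cabs a + 2.
have M2 : 2 <= M by rewrite /M; have := cabs_ge0 P.[a]; have := cabs_ge0 a; lra.
pose e1 := Num.min 1 (e / (2 * M)).
have e10 : 0 < e1 by rewrite lt_min ltr01 divr_gt0 // mulr_gt0 //; lra.
have [d d0 hd] := IH e1 e10.
exists (Num.min d e1); first by rewrite lt_min d0.
move=> x; rewrite le_min => /andP[/hd hx xa].
rewrite !hornerMXaddC.
have -> : P.[x] * x + c - (P.[a] * a + c) =
  (P.[x] - P.[a]) * (x - a) + ((P.[x] - P.[a]) * a + P.[a] * (x - a)) by ring.
have e11 : e1 <= 1 by rewrite /e1 ge_min lexx.
have e1e : e1 * (2 * M) <= e.
  by rewrite -ler_pdivlMr ?mulr_gt0 //; [rewrite /e1 ge_min lexx orbT|lra].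
have t1 := ler_cabsD ((P.[x] - P.[a]) * (x - a)) ((P.[x] - P.[a]) * a + P.[a] * (x - a)).
have t2 := ler_cabsD ((P.[x] - P.[a]) * a) (P.[a] * (x - a)).
move: t1 t2; rewrite !cabsM => t1 t2.
have a0 := cabs_ge0 a; have pa0 := cabs_ge0 P.[a].
have x0 := cabs_ge0 (x - a); have px0 := cabs_ge0 (P.[x] - P.[a]).
have := ler_pM px0 x0 hx xa.
have := ler_wpM2r a0 hx.
have := ler_wpM2l pa0 xa.
have : e1 * e1 <= e1 * 1 by rewrite ler_pM2l.
move: e1e; rewrite /M; nra.
Qed.

Lemma ler_cabs_lim (P Q : {poly C}) :
  (forall e : R, 0 < e -> cabs P.[e%:C] <= cabs Q.[e%:C]) ->
  cabs P.[0] <= cabs Q.[0].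
Proof.
move=> h; rewrite leNgt; apply/negP => lt.
pose g := (cabs P.[0] - cabs Q.[0]) / 4.
have g0 : 0 < g by rewrite /g divr_gt0 //; lra.
have [d1 d10 h1] := poly_cont P 0 g0.
have [d2 d20 h2] := poly_cont Q 0 g0.
pose e := Num.min d1 d2.
have e0 : 0 < e by rewrite lt_min d10.
have ce : cabs (e%:C - 0) = e by rewrite subr0 cabs_real gtr0_norm.
have k1 : cabs (P.[e%:C] - P.[0]) <= g by apply: h1; rewrite ce ge_min lexx.
have k2 : cabs (Q.[e%:C] - Q.[0]) <= g.
  by apply: h2; rewrite ce ge_min lexx orbT.
have t1 := ler_cabsD (P.[0] - P.[e%:C]) P.[e%:C].
have t2 := ler_cabsD (Q.[e%:C] - Q.[0]) Q.[0].
rewrite !subrK cabs_distC in t1 t2; have t3 := h _ e0.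
have gE : g * 4 = cabs P.[0] - cabs Q.[0] by rewrite /g; field.
by move: t2; rewrite cabs_distC => t2; rewrite cabs_distC in k2; lra.
Qed.

(* A root can leave the lower half-plane along [s] only through the real axis:
   [lhp_roots (F s)] holds at [s = 0] and is both open and closed in [s]. *)
Section Homotopy.
Variables (G : {poly {poly C}}) (c : C).
Hypothesis lcG : lead_coef G = c%:P.
Hypothesis c0 : c != 0.

Local Notation F s := (map_poly (horner_eval (s : R)%:C) G).
Definition lhp_roots (P : {poly C}) := forall w, 0 <= Im w -> P.[w] != 0.

Let lcF (s : R) : lead_coef (F s) = c.
Proof.
have h : horner_eval s%:C (lead_coef G) != 0 by rewrite lcG /horner_eval hornerC.
by rewrite lead_coef_map_eq lcG /= /horner_eval hornerC.
Qed.

Let hFE (s : R) (w : C) :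
  (F s).[w] = (\sum_(i < size G) G`_i * (w ^+ i)%:P).[s%:C].
Proof.
rewrite (horner_coef_wide _ (size_poly _ _)) horner_sum.
by apply: eq_bigr => i _; rewrite hornerM hornerC coef_map.
Qed.

(** If all roots of [F s'] were at distance at least [y = Im w0] from [w0], the modulus of the value
    at [w0] would be at least [cabs c * y ^+ N.-1]. Continuity makes it at most half of that, so
    some root is closer than [y], hence above the real axis. *)
Let bad_open (s : R) w0 : 0 < Im w0 -> (F s).[w0] = 0 ->
  exists2 d : R, 0 < d & forall s', `|s' - s| <= d ->
    exists2 w, 0 < Im w & (F s').[w] = 0.
Proof.
move=> w00 Fw0.
have [N sN] : exists N, forall s', size (F s') = N.
  exists (size G) => s'; rewrite size_map_poly_id0 // lcG.
  by rewrite /horner_eval hornerC.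
pose y := Im w0.
have lt0 : 0 < cabs c * y ^+ N.-1 / 2.
  by rewrite divr_gt0 // mulr_gt0 ?exprn_gt0 // lt0r cabs_eq0 c0 cabs_ge0.
have [d d0 hd] := poly_cont (\sum_(i < size G) G`_i * (w0 ^+ i)%:P) s%:C lt0.
exists d => // s' hs'.
have := hd s'%:C; rewrite -rmorphB cabs_real -!hFE Fw0 subr0 => /(_ hs') k.
have [r Er] := closed_field_poly_normal (F s').
have sr : size r = N.-1.
  have := sN s'; rewrite Er size_scale ?lcF //.
  by rewrite size_prod_XsubC => <-.
have [/hasP[a ar alt]|/hasPn h] := boolP (has (fun a => cabs (w0 - a) < y) r).
  exists a.
    have := ler_Im_cabs (w0 - a); rewrite ImD ImN.
    by have := ler_norm (Im w0 - Im a); rewrite /y in alt *; lra.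
  rewrite Er hornerZ horner_prod (big_rem a) //=.
  by rewrite hornerXsubC subrr mul0r mulr0.
suff : cabs c * y ^+ N.-1 <= cabs (F s').[w0] by lra.
rewrite Er hornerZ lcF cabsM ler_wpM2l ?cabs_ge0 //.
rewrite horner_prod cabs_prod.
have -> : y ^+ N.-1 = \prod_(a <- r) y by rewrite big_const_seq count_predT iter_mulr_1 sr.
rewrite big_seq [leRHS]big_seq; apply: ler_prod => a /h.
by rewrite -leNgt hornerXsubC => ->; rewrite ltW.
Qed.

(** The half-plane is not compact; a lower bound growing with the full degree makes a small
    perturbation of the coefficients harmless uniformly in [w]. *)
Let lhp_lower P : P != 0 -> lhp_roots P ->
  exists2 k : R, 0 < k & forall w, 0 <= Im w ->
    k * (1 + cabs w) ^+ (size P).-1 <= cabs P.[w].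
Proof.
move=> P0 h; have [r Er] := closed_field_poly_normal P.
have rP : {in r, forall a, Im a < 0}.
  move=> a ar; rewrite ltNge; apply/negP => /h.
  by rewrite Er hornerZ horner_prod (big_rem a) //= hornerXsubC subrr mul0r mulr0 eqxx.
have sr : size r = (size P).-1.
  by rewrite Er size_scale ?lead_coef_eq0 // size_prod_XsubC.
have [k k0 hk] : exists2 k : R, 0 < k & forall w, 0 <= Im w ->
    k * (1 + cabs w) ^+ size r <= \prod_(a <- r) cabs (w - a).
  elim: {Er sr} r rP => [|a r IH] rP.
    by exists 1 => // w _; rewrite big_nil expr0 mulr1.
  have [k k0 hk] : exists2 k : R, 0 < k & forall w, 0 <= Im w ->
      k * (1 + cabs w) ^+ size r <= \prod_(a <- r) cabs (w - a).
    by apply: IH => b br; apply: rP; rewrite inE br orbT.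
  have a0 : Im a < 0 by apply: rP; rewrite inE eqxx.
  pose M := 1 + (1 + cabs a) / - Im a.
  have M0 : 0 < M.
    rewrite ltr_wpDr // divr_ge0 //; last by lra.
    by have := cabs_ge0 a; lra.
  exists (M^-1 * k); first by rewrite mulr_gt0 // invr_gt0.
  move=> w w0; rewrite big_cons exprS.
  have -> : M^-1 * k * ((1 + cabs w) * (1 + cabs w) ^+ size r) =
    (M^-1 * (1 + cabs w)) * (k * (1 + cabs w) ^+ size r) by ring.
  have cw := cabs_ge0 w.
  apply: ler_pM; last exact: hk.
  - by rewrite mulr_ge0 ?invr_ge0 ?ltW //; lra.
  - by rewrite mulr_ge0 ?exprn_ge0 ?ltW //; lra.
  rewrite mulrC ler_pdivrMr //.
  have t := ler_cabsD (w - a) a; rewrite subrK in t.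
  have := ler_Im_cabs (w - a); rewrite ImD ImN => t2.
  have {}t2 : - Im a <= cabs (w - a).
    by apply: le_trans t2; apply: le_trans (ler_norm _); lra.
  have : (1 + cabs a) <= cabs (w - a) * ((1 + cabs a) / - Im a).
    rewrite mulrCA -[leLHS]mulr1 ler_wpM2l ?ler_pdivlMr; have := cabs_ge0 a; lra.
  by rewrite /M mulrDr mulr1; lra.
exists (cabs (lead_coef P) * k).
  by rewrite mulr_gt0 // lt0r cabs_ge0 cabs_eq0 lead_coef_eq0 P0.
move=> w w0; rewrite -sr {2}Er hornerZ cabsM -mulrA ler_wpM2l ?cabs_ge0 //.
rewrite horner_prod cabs_prod; under eq_bigr do rewrite hornerXsubC.
exact: hk.
Qed.

Let coef_cont (s e : R) : 0 < e -> exists2 d : R, 0 < d &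
  forall s', `|s' - s| <= d -> forall i : nat, cabs ((G`_i).[s'%:C] - (G`_i).[s%:C]) <= e.
Proof.
move=> e0.
have [d d0 hd] : exists2 d : R, 0 < d & forall s', `|s' - s| <= d ->
    forall i : nat, (i < size G)%N -> cabs ((G`_i).[s'%:C] - (G`_i).[s%:C]) <= e.
  elim: (size G) => [|m [d d0 hd]]; first by exists 1.
  have [d1 d10 hd1] := poly_cont G`_m s%:C e0.
  exists (Num.min d d1); first by rewrite lt_min d0.
  move=> s'; rewrite le_min => /andP[h1 h2] i; rewrite ltnS leq_eqVlt.
  case/orP => [/eqP ->|im]; last exact: hd.
  by apply: hd1; rewrite -rmorphB cabs_real.
exists d => // s' hs' i; have [|ge] := ltnP i (size G); first exact: hd.
by rewrite nth_default // !horner0 subrr cabs0 ltW.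
Qed.

Let good_open (s : R) : lhp_roots (F s) ->
  exists2 d : R, 0 < d & forall s', `|s' - s| <= d -> lhp_roots (F s').
Proof.
move=> hs; have F0 : F s != 0 by rewrite -lead_coef_eq0 lcF.
have [k k0 hk] := lhp_lower F0 hs.
have sF : size (F s) = size G.
  by rewrite size_map_poly_id0 // lcG /horner_eval hornerC.
rewrite sF in hk; pose N := size G.
have G0 : (0 < N)%N.
  by rewrite lt0n size_poly_eq0 -lead_coef_eq0 lcG polyC_eq0.
(* [N] coefficients, each perturbed by at most [k / (2 * N)], change the value by at most half of
   the lower bound. *)
have e0 : 0 < k / (2 * N%:R).
  by rewrite divr_gt0 // mulr_gt0 ?ltr0n.
have [d d0 hd] := coef_cont s e0.
exists d => // s' /hd{}hd w w0; apply/eqP => Fw.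
have := hk _ w0; apply/negP; rewrite -ltNge.
rewrite -[_.[w]]subr0 -Fw cabs_distC !hFE !horner_sum -sumrB.
apply: le_lt_trans (ler_cabs_sum _ _) _.
have c1 : 1 <= 1 + cabs w by have := cabs_ge0 w; lra.
have cp : 0 < (1 + cabs w) ^+ N.-1 by apply: exprn_gt0; lra.
apply: (@le_lt_trans _ _ (\sum_(i < N) k / (2 * N%:R) * (1 + cabs w) ^+ N.-1)).
  apply: ler_sum => i _; rewrite !hornerM !hornerC -mulrBl cabsM.
  apply: ler_pM; rewrite ?cabs_ge0 ?hd // cabsX.
  have iN : (i <= N.-1)%N by rewrite -ltnS prednK.
  apply: le_trans (ler_weXn2l c1 iN).
  by rewrite lerXn2r ?nnegrE ?cabs_ge0 //; have := cabs_ge0 w; lra.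
rewrite sumr_const card_ord -[ltLHS]mulr_natl mulrA.
have -> : N%:R * (k / (2 * N%:R)) = k / 2.
  by field; rewrite pnatr_eq0 -lt0n.
by rewrite ltr_pM2r //; lra.
Qed.

Lemma homotopy_roots :
  (forall (s x : R), 0 <= s <= 1 -> (F s).[x%:C] != 0) ->
  lhp_roots (F 0) -> lhp_roots (F 1).
Proof.
move=> nr g0.
pose A : classical_sets.set R := fun s => 0 <= s <= 1 /\
  forall s', 0 <= s' <= s -> lhp_roots (F s').
have A0 : A 0.
  split=> [|s' hs']; first by rewrite lexx ler01.
  by have -> : s' = 0 by lra.
have supA : classical_sets.has_sup A.
  by split; [exists 0|exists 1 => s [/andP[]]].
pose t := sup A.
have t0 : 0 <= t by apply: ub_le_sup A0; case: supA.
have t1 : t <= 1 by apply: ge_sup; [exists 0|move=> s [/andP[]]].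
have below s' : 0 <= s' < t -> lhp_roots (F s').
  move=> /andP[s0 st]; rewrite -subr_gt0 in st.
  have [e [_ he] lt] := sup_adherent st supA.
  by apply: he; rewrite -/t in lt; lra.
(* At the supremum a real root is excluded by [nr], and a root above the real axis would persist for
   some smaller parameter. *)
have goodt : lhp_roots (F t).
  move=> w w0; apply/eqP => Fw.
  have [/eqP w00|w00] := boolP (Im w == 0).
    have /negP[] := nr t (Re w) (introT andP (conj t0 t1)).
    by rewrite (_ : (Re w)%:C = w) ?Fw //; case: w {w0 Fw} w00 => a b /= ->.
  have {}w0 : 0 < Im w by rewrite lt0r w00.
  have {}t0 : 0 < t.
    rewrite lt0r t0 andbT; apply: contra_eqN Fw => /eqP ->.
    by apply: g0; apply: ltW.
  have [d d0 hd] := bad_open w0 Fw.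
  have [|v v0 Fv] := hd (Num.max 0 (t - d)).
    by rewrite ler_norml; case: (lerP 0 (t - d)) => ?; lra.
  suff: 0 <= Num.max 0 (t - d) < t.
    by move=> /below/(_ _ (ltW v0)); rewrite Fv eqxx.
  by case: (lerP 0 (t - d)) => ?; lra.
have [d d0 hd] := good_open goodt.
suff At : A (Num.min 1 (t + d)).
  have : Num.min 1 (t + d) <= t by apply: ub_le_sup At; case: supA.
  by rewrite ge_min => h; have -> : 1 = t by lra.
split=> [|s' hs']; first by case: (lerP 1 (t + d)) => ?; lra.
have : 0 <= s' <= t + d.
  by move: hs'; rewrite le_min => /andP[-> /andP[]].
move=> /andP[s0 sd]; have [st|ts] := ltP s' t; first by apply: below; rewrite s0.
by apply: hd; rewrite ler_norml; lra.
Qed.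
End Homotopy.
End HalfPlane.

(** * Real stable polynomials *)

Section Substitution.

Lemma rmorph_mmap (n : nat) (A : nzRingType) (S T : comNzRingType)
    (phi : {rmorphism S -> T}) (f : A -> S) (h : 'I_n -> S) (p : {mpoly A[n]}) :
  phi (mmap f h p) = mmap (phi \o f) (phi \o h) p.
Proof.
rewrite /mmap rmorph_sum; apply: eq_bigr => m _; rewrite rmorphM /=.
by congr (_ * _); rewrite /mmap1 rmorph_prod; apply: eq_bigr => i _; rewrite rmorphXn.
Qed.

Lemma eq_mmap (n : nat) (A S : nzRingType) (f g : A -> S) (h k : 'I_n -> S) (p : {mpoly A[n]}) :
  f =1 g -> h =1 k -> mmap f h p = mmap g k p.
Proof.
move=> fg hk; rewrite /mmap; apply: eq_bigr => m _; rewrite fg.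
by congr (_ * _); apply: mmap1_eq.
Qed.

Lemma top_coefM (S : comNzRingType) (P Q : {poly S}) (d e : nat) :
  (size P <= d.+1)%N -> (size Q <= e.+1)%N ->
  (size (P * Q)%R <= (d + e).+1)%N /\ (P * Q)`_(d + e) = P`_d * Q`_e.
Proof.
move=> sP sQ; split; first by have := size_polyMleq P Q; lia.
have de : (d < (d + e).+1)%N by lia.
rewrite coefM (bigD1 (Ordinal de)) //= addKn big1 ?addr0 // => -[j /= hj] /eqP jd.
have [jlt|jge] := ltnP j d; last first.
  have {}jd : (j <> d)%N by move=> e1; apply: jd; apply: val_inj.
  by rewrite [P`_j]nth_default ?mul0r //; apply: leq_trans sP _; lia.
by rewrite [Q`_ _]nth_default ?mulr0 //; apply: leq_trans sQ _; lia.
Qed.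

(** Only the parts [b i * 'X] reach degree [d]; hence the degree along a line is exactly [d] when
    [p] does not vanish at the direction [b]. *)
Lemma mmap_affine (n d : nat) (A S : comNzRingType) (f : A -> S)
    (a b : 'I_n -> S) (p : {mpoly A[n]}) :
  p \is d.-homog ->
  let P := mmap (polyC \o f) (fun i => (a i)%:P + (b i)%:P * 'X) p in
  (size P <= d.+1)%N /\ P`_d = mmap f b p.
Proof.
move=> /dhomogP hp P; pose lin i : {poly S} := (a i)%:P + (b i)%:P * 'X.
have H m : m \in msupp p ->
    (size (mmap1 lin m) <= d.+1)%N /\ (mmap1 lin m)`_d = mmap1 b m.
  move=> mp; have <- : mdeg m = d := hp m mp; rewrite mdegE /mmap1.
  elim/big_rec3: _ => [|i Q k c _ [sQ cQ]].
    by rewrite size_poly1 coef1.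
  rewrite -cQ.
  have [s1 c1] : (size (lin i ^+ m i)%R <= (m i).+1)%N /\
     (lin i ^+ m i)`_(m i) = b i ^+ m i.
    elim: (m i) => [|j [sj cj]]; first by rewrite !expr0 size_poly1 coef1.
    rewrite !exprS -cj -add1n.
    have sl : (size (lin i) <= 2)%N.
      rewrite /lin addrC size_MXaddC; case: ifP => // _.
      by have := size_polyC (b i); case: (b i != 0) => ->.
    have [-> ->] := top_coefM sl sj; split=> //.
    by rewrite /lin coefD coefC /= coefMX coefC /= add0r.
  by have [s2 ->] := top_coefM s1 sQ; rewrite s2 c1.
split.
  apply: (leq_trans (size_sum _ _ _)); rewrite big_seq.
  apply/bigmax_leqP_seq => m mp _ /=.
  rewrite mul_polyC; apply: leq_trans (size_scale_leq _ _) _.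
  by case: (H m mp).
rewrite /P /mmap coef_sum big_seq [RHS]big_seq; apply: eq_bigr => m mp /=.
by rewrite coefCM; case: (H m mp) => _ ->.
Qed.

Lemma size_dvd_split (F : fieldType) (P : {poly F}) (s : seq F) :
  P != 0 -> (forall a, count_mem a s = mup a P) -> (size P <= (size s).+1)%N ->
  P = lead_coef P *: \prod_(a <- s) ('X - a%:P).
Proof.
elim: s P => [|a s IH] P P0 cs sP.
  have s1 : (size P <= 1)%N := sP.
  rewrite big_nil alg_polyC lead_coefE (_ : (size P).-1 = 0%N); last by lia.
  exact: size1_polyC.
have : 'X - a%:P %| P by rewrite XsubC_dvd // -cs /= eqxx.
move=> /dvdpP[Q PQ].
have Q0 : Q != 0 by apply: contraNneq P0 => Q0; rewrite PQ Q0 mul0r.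
have QE : Q = lead_coef Q *: \prod_(b <- s) ('X - b%:P).
  apply: IH => // [b|]; last first.
    by move: sP; rewrite PQ size_Mmonic ?monicXsubC // size_XsubC addn2.
  have := cs b; rewrite PQ mupM ?polyXsubC_eq0 //= -['X - a%:P]expr1 mup_XsubCX.
  by case: (a == b); rewrite ?add1n ?addn1 ?add0n ?addn0 // => -[].
by rewrite big_cons PQ lead_coef_Mmonic ?monicXsubC // {1}QE mulrC scalerAr.
Qed.

End Substitution.

Section Stable.
Variables (R : realType) (n : nat).
Local Notation C := R[i].
Local Notation "x %:C" := (real_complex R x) (format "x %:C").
Local Notation Re := (@complex.Re R).
Local Notation Im := (@complex.Im R).
Implicit Types (p : {mpoly R[n]}) (z w y : 'I_n -> C).

Definition ev p z : C := mmap (real_complex R) z p.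

Definition line p z y : {poly C} :=
  mmap (polyC \o real_complex R) (fun i => (z i)%:P + (y i)%:P * 'X) p.

Definition unit_dir (j : 'I_n) : 'I_n -> C := fun i => (i == j)%:R.

Lemma eq_ev p z w : z =1 w -> ev p z = ev p w.
Proof. exact: eq_mmap. Qed.

Lemma line_eval p z y (t : C) : (line p z y).[t] = ev p (fun i => z i + y i * t).
Proof.
rewrite -[LHS]/(horner_eval t (line p z y)) rmorph_mmap.
by apply: eq_mmap => x /=; rewrite /horner_eval !hornerE.
Qed.

Lemma evZ p d (c : C) z : p \is d.-homog -> ev p (fun i => c * z i) = c ^+ d * ev p z.
Proof.
move=> /dhomogP hp; rewrite /ev /mmap mulr_sumr big_seq [RHS]big_seq.
apply: eq_bigr => m mp; have md : mdeg m = d := hp m mp; rewrite mulrCA; congr (_ * _).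
rewrite /mmap1 -md mdegE -prodrXr -big_split /=.
by apply: eq_bigr => i _; rewrite exprMn.
Qed.

Lemma ev_real p (x : 'I_n -> R) : ev p (fun i => (x i)%:C) = (p.@[x])%:C.
Proof. by rewrite /meval rmorph_mmap; apply: eq_mmap. Qed.

Lemma line_deriv p z j : (line p z (unit_dir j))^`() = line p^`M(j) z (unit_dir j).
Proof.
have lineZ (c : R) q : line (c *: q) z (unit_dir j) = c%:C%:P * line q z (unit_dir j).
  exact: (mmapZ _ (polyC \o real_complex R)).
have lineS (I : Type) (r : seq I) (F : I -> {mpoly R[n]}) :
    line (\sum_(i <- r) F i) z (unit_dir j) = \sum_(i <- r) line (F i) z (unit_dir j).
  exact: (raddf_sum (mmap (polyC \o real_complex R) (fun i => (z i)%:P + (unit_dir j i)%:P * 'X))).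
have lineX (m : 'X_{1..n}) : line 'X_[m] z (unit_dir j) =
    ((z j)%:P + 'X) ^+ m j * (\prod_(i < n | i != j) z i ^+ m i)%:P.
  rewrite [LHS](mmapX _ (polyC \o real_complex R)) /mmap1 (bigD1 j) //=.
  rewrite /unit_dir eqxx mul1r rmorph_prod; congr (_ * _).
  by apply: eq_bigr => i /negPf ->; rewrite mul0r addr0 -rmorphXn.
have DX (m : 'X_{1..n}) : (line 'X_[m] z (unit_dir j))^`() = line ('X_[m])^`M(j) z (unit_dir j).
  rewrite mderivX lineZ !lineX derivM derivC mulr0 addr0 deriv_exp.
  rewrite derivD derivC derivX add0r mul1r mulrA !rmorph_nat mulr_natl mnmBE mnm1E eqxx subn1.
  congr (_ * _%:P); apply: eq_bigr => i ij.
  by rewrite mnmBE mnm1E eq_sym (negPf ij) subn0.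
rewrite [p in LHS]mpolyE [p in RHS]mpolyE lineS raddf_sum [in RHS]raddf_sum lineS.
apply: eq_bigr => m _ /=; rewrite mderivZ !lineZ derivM derivC mul0r add0r.
by rewrite DX.
Qed.

Lemma dhomog_mderiv p d j : p \is d.+1.-homog -> p^`M(j) \is d.-homog.
Proof.
move=> /dhomogP hp; apply/dhomogP => m; rewrite mcoeff_msupp mcoeff_deriv => h.
have : (m + U_(j))%MM \in msupp p.
  by rewrite mcoeff_msupp; apply: contraNneq h => ->; rewrite mul0rn.
by move/hp => h'; have : mdeg (m + U_(j)) = d.+1 := h'; rewrite mdegD mdeg1 addn1 => -[].
Qed.

Definition nonvanishing p := forall z, (forall i, 0 < Im (z i)) -> ev p z != 0.

(* For [p <> 0] this is equivalent to [nonvanishing p], but it is preserved by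
   limits. *)
Definition im_mono p := forall z w,
  (forall i, Re (z i) = Re (w i) /\ 0 <= Im (z i) <= Im (w i)) ->
  cabs (ev p z) <= cabs (ev p w).

Definition upd z (j : 'I_n) (t : C) : 'I_n -> C := fun i => if i == j then t else z i.

Lemma line_upd p z j t : (line p (upd z j 0) (unit_dir j)).[t] = ev p (upd z j t).
Proof.
rewrite line_eval; apply: eq_ev => i; rewrite /upd /unit_dir.
by case: eqP; rewrite ?add0r ?mul1r ?mul0r ?addr0.
Qed.

Lemma nonvanishing_uhp p z j : nonvanishing p -> (forall i, 0 < Im (z i)) ->
  uhp (line p (upd z j 0) (unit_dir j)).
Proof.
move=> nv z0 t t0; rewrite line_upd; apply: nv => i.
by rewrite /upd; case: eqP.
Qed.

(** In a single variable this is [uhp_cabs_mono], so coordinates are replaced one by one. Real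
    coordinates are reached by shifting every coordinate by ['i * e] and letting [e] tend to 0. *)
Lemma nonvanishing_mono p : nonvanishing p -> im_mono p.
Proof.
move=> nv.
have open z w : (forall i, Re (z i) = Re (w i) /\ 0 < Im (z i) <= Im (w i)) ->
    cabs (ev p z) <= cabs (ev p w).
  move=> h; pose hyb (k : nat) (i : 'I_n) : C := if (i < k)%N then w i else z i.
  have hyb0 k i : 0 < Im (hyb k i).
    by have := h i; rewrite /hyb; case: ifP => _; lra.
  suff: forall k, (k <= n)%N -> cabs (ev p z) <= cabs (ev p (hyb k)).
    move=> /(_ n (leqnn n)) /le_trans; apply.
    by rewrite (@eq_ev p _ w) // => i; rewrite /hyb ltn_ord.
  elim=> [_|k IH kn]; first by rewrite (@eq_ev p _ z).
  apply: (le_trans (IH (ltnW kn))).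
  pose j := Ordinal kn.
  have e1 : hyb k =1 upd (hyb k) j (z j).
    by move=> i; rewrite /upd; case: eqP => // ->; rewrite /hyb /= ltnn.
  have e2 : hyb k.+1 =1 upd (hyb k) j (w j).
    move=> i; rewrite /upd; case: eqP => [->|]; rewrite /hyb /= ltnS ?leqnn //.
    by move=> /eqP; rewrite -val_eqE /= leq_eqVlt => /negPf ->.
  rewrite (eq_ev _ e1) (eq_ev _ e2) -!line_upd; apply: uhp_cabs_mono.
  - exact: nonvanishing_uhp.
  - by case: (h j).
  - by have := h j; lra.
move=> z w h.
have -> : ev p z = (line p z (fun=> 'i%C)).[0].
  by rewrite line_eval; apply: eq_ev => i; rewrite mulr0 addr0.
have -> : ev p w = (line p w (fun=> 'i%C)).[0].
  by rewrite line_eval; apply: eq_ev => i; rewrite mulr0 addr0.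
apply: ler_cabs_lim => e e0; rewrite !line_eval; apply: open => i.
by rewrite !ReD !ImD ![_ * e%:C]mulrC !ReZ !ImZ /=; have := h i; lra.
Qed.

Lemma poly_vertical0 (P : {poly C}) (x y : R) : 0 < y ->
  (forall s, 0 < s <= y -> P.[Complex x s] = 0) -> P = 0.
Proof.
move=> y0 h; apply/eqP; apply/negPn/negP => P0.
pose s := [seq Complex x (y / k.+1%:R) | k <- iota 0 (size P)].
have := @max_poly_roots _ P s P0; rewrite size_map size_iota ltnn => hs.
suff: false by []; apply: hs; last first.
  rewrite map_inj_uniq ?iota_uniq // => k l [] /(mulfI (lt0r_neq0 y0)) /invr_inj /eqP.
  by rewrite eqr_nat => /eqP[].
apply/allP => _ /mapP[k _ ->]; apply/eqP/h.
by rewrite divr_gt0 ?ltr0n //= ler_pdivrMr ?ltr0n // ler_peMr ?ler1n // ltW.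
Qed.

(* The zero set of an [im_mono] polynomial contains a box as soon as it meets
   the product of upper half-planes. *)
Lemma mono_nonvanishing p d : p \is d.-homog -> im_mono p -> p != 0 -> nonvanishing p.
Proof.
move=> hp mono p0 z z0; apply: contraNneq p0 => pz.
have : forall w, (forall i, Re (w i) = Re (z i) /\ 0 < Im (w i) <= Im (z i)) -> ev p w = 0.
  move=> w hw; apply/eqP; rewrite -cabs_eq0 eq_le cabs_ge0 andbT.
  by rewrite -[leRHS](cabs0 R) -pz; apply: mono => i; have := hw i; lra.
move=> {mono pz} h; elim: d p hp h => [|d IH] p hp h.
  have pc : p = (p@_0)%:MP.
    apply/mpolyP => m; rewrite mcoeffC; case: eqVneq => [<-|m0]; first by rewrite mulr1.
    by rewrite mulr0; apply: (dhomog_nemf_coeff hp); rewrite /= mdeg_eq0.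
  have := h z (fun i => conj erefl (introT andP (conj (z0 i) (lexx _)))).
  rewrite /ev pc mmapC => /eqP; rewrite fmorph_eq0 => /eqP ->.
  by rewrite mpolyC0.
(* In positive degree every coefficient shows up in some partial derivative. These vanish on the
   same box, since [p] vanishes on vertical segments in each variable, so the induction on the
   degree applies to them. *)
suff D j : p^`M(j) = 0.
  apply/eqP/mpolyP => m; rewrite mcoeff0.
  have [m0|m0] := eqVneq (mdeg m) d.+1; last by rewrite (dhomog_nemf_coeff hp).
  have [j mj] : exists j, (0 < m j)%N.
    apply/existsP; apply: contra_eqT m0; rewrite negb_exists => /forallP h0.
    by rewrite mdegE big1 // => i _; have := h0 i; rewrite lt0n negbK => /eqP.
  have := congr1 (mcoeff (m - U_(j))%MM) (D j).
  rewrite mcoeff0 mcoeff_deriv submK ?lep1mP ?lt0n_neq0 //.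
  by move/eqP; rewrite mulrn_eq0 => /eqP.
apply/eqP; apply: IH => [|w hw]; first exact: dhomog_mderiv.
have w0 : forall i, 0 < Im (w i) by move=> i; have := hw i; lra.
have L0 : line p (upd w j 0) (unit_dir j) = 0.
  apply: (@poly_vertical0 _ (Re (z j)) (Im (z j))) => // s hs.
  rewrite line_upd; apply: h => i; rewrite /upd; case: eqP => [->|_] /=; [by split|exact: hw].
have -> : ev p^`M(j) w = (line p^`M(j) (upd w j 0) (unit_dir j)).[w j].
  by rewrite line_upd; apply: eq_ev => i; rewrite /upd; case: eqP => [->|].
by rewrite -line_deriv L0 deriv0 horner0.
Qed.

(* On a vertical line the logarithmic derivative has negative imaginary part,
   so [p^`M(j) + e *: p] does not vanish; then let [e] tend to 0. *)
Lemma nonvanishing_mderiv p d j : p \is d.+1.-homog -> nonvanishing p ->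
  p^`M(j) = 0 \/ nonvanishing p^`M(j).
Proof.
move=> hp nv; have [|D0] := eqVneq p^`M(j) 0; [by left|right].
apply: mono_nonvanishing (dhomog_mderiv j hp) _ D0.
have Tnv (e : R) : e != 0 -> nonvanishing (p^`M(j) + e *: p).
  move=> e0 z z0.
  have := @uhp_deriv_addZ _ _ e (nonvanishing_uhp j nv z0).
  rewrite e0 orbT => /(_ isT (z j) (z0 j)); rewrite line_deriv hornerD hornerZ !line_upd.
  have zE : upd z j (z j) =1 z by move=> i; rewrite /upd; case: eqP => [->|].
  by rewrite !(eq_ev _ zE) /ev mmapD mmapZ.
move=> z w h.
have P0 x : ev p^`M(j) x = ((ev p^`M(j) x)%:P + ev p x *: 'X).[0] by rewrite !hornerE.
rewrite (P0 z) (P0 w).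
apply: ler_cabs_lim => e e0.
have := nonvanishing_mono (Tnv e (lt0r_neq0 e0)) h.
by rewrite /ev !mmapD !mmapZ !hornerE ![_ * e%:C]mulrC.
Qed.
End Stable.

(** * Garding's theorem: hyperbolic polynomials do not vanish on the product of upper half-planes *)

Section Garding.
Variables (R : realType) (n : nat).
Local Notation C := R[i].
Local Notation "x %:C" := (real_complex R x) (format "x %:C").
Local Notation Re := (@complex.Re R).
Local Notation Im := (@complex.Im R).
Variable p : {mpoly R[n]}.
Hypothesis hyp : P_hyperbolic p.

Let homp : p \is n.-homog. Proof. by case: hyp. Qed.

Let line_split (x : 'I_n -> R) : exists (c : R) (s : seq R),
  [/\ c != 0, line_poly p x = c *: \prod_(a <- s) ('X - a%:P)
    & {in s, forall a, root (line_poly p x) a}].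
Proof.
case: hyp => _ /(_ x)[s [P0 cs] ss] _ _.
have E : line_poly p x = mmap (polyC \o id) (fun i => (x i)%:P + (-1)%:P * 'X) p.
  by apply: eq_mmap => i //=; rewrite rmorphN1 mulN1r.
have sP : (size (line_poly p x) <= (size s).+1)%N.
  by rewrite ss E; case: (mmap_affine (idfun : {rmorphism R -> R}) x (fun=> -1) homp).
exists (lead_coef (line_poly p x)), s; split.
- by rewrite lead_coef_eq0.
- exact: size_dvd_split.
by move=> a; rewrite -has_pred1 has_count cs -XsubC_dvd // dvdp_XsubCl.
Qed.

Let line_ev (x : 'I_n -> R) (w : C) :
  (map_poly (real_complex R) (line_poly p x)).[w] = ev p (fun i => (x i)%:C - w).
Proof.
rewrite -[LHS]/(horner_eval w _) /line_poly !rmorph_mmap.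
apply: eq_mmap => i /=; rewrite ?map_polyC /horner_eval ?hornerC //.
by rewrite rmorphB /= map_polyC map_polyX !hornerE.
Qed.

Let ev_root (x : 'I_n -> R) (w : C) : ev p (fun i => (x i)%:C - w) = 0 ->
  exists2 a : R, w = a%:C & root (line_poly p x) a.
Proof.
rewrite -line_ev; have [c [s [c0 E hs]]] := line_split x.
rewrite E map_polyZ hornerZ rmorph_prod horner_prod => /eqP.
rewrite mulf_eq0 fmorph_eq0 (negPf c0) /= prodf_seq_eq0 => /hasP[a /hs ha /=].
rewrite rmorphB /= map_polyX map_polyC hornerXsubC subr_eq0 => /eqP ->.
by exists a; rewrite -?E.
Qed.

(** The case of equal imaginary parts: a zero would be a non-real root of [line_poly p x]. *)
Let base (x : 'I_n -> R) (eta : R) : 0 < eta ->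
  ev p (fun i => Complex (x i) eta) != 0.
Proof.
move=> eta0; apply/eqP => H.
have [|a] := @ev_root x (Complex 0 (- eta)).
  rewrite -H; apply: eq_ev => i.
  by rewrite /real_complex_def /= -[LHS]/(Complex _ _) subr0 sub0r opprK.
by case=> _ /eqP; rewrite oppr_eq0 gt_eqF.
Qed.

Section Step.
Variables (k : 'I_n) (eps : R).
Hypothesis eps0 : 0 < eps.
Let e : 'I_n -> R := fun i => (i == k)%:R + eps.

(** A zero would be the negative root [- eps] of [line_poly p (std_basis k)]. This value is the
    leading coefficient in the homotopy below. *)
Let e_neq0 : ev p (fun i => (e i)%:C) != 0.
Proof.
apply/eqP => H; have [|a] := @ev_root (std_basis k) (- eps%:C).
  by rewrite -H; apply: eq_ev => i; rewrite opprK /e rmorphD.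
rewrite -rmorphN => /complexI <-; case: hyp => _ _ _ h /h.
by rewrite oppr_ge0 leNgt eps0.
Qed.

Let start (eta : R) : 0 < eta ->
  lhp_roots (line p (fun=> Complex 0 eta) (fun i => (e i)%:C)).
Proof.
move=> eta0 w w0; apply/eqP; rewrite line_eval => H.
have [w00|w00] := eqVneq w 0.
  have /negP[] := base (fun=> 0) eta0; rewrite -[X in _ == X]H; apply/eqP.
  by apply: eq_ev => i; rewrite w00 mulr0 addr0.
have : ev p (fun i => (std_basis k i)%:C - - (eps%:C + Complex 0 eta / w)) = 0.
  apply/eqP; have := evZ w (fun i => (std_basis k i)%:C - - (eps%:C + Complex 0 eta / w)) homp.
  rewrite (_ : ev p _ = 0) => [/esym/eqP|].
    by rewrite mulf_eq0 expf_eq0 (negPf w00) andbF.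
  rewrite -H; apply: eq_ev => i; rewrite /e opprK rmorphD /std_basis.
  by field.
move=> /ev_root[a aE ra]; have a0 : 0 <= a by case: hyp => _ _ _ h; exact: h ra.
have : Complex 0 eta = w * (- (a + eps))%:C.
  have -> : (- (a + eps))%:C = Complex 0 eta / w by rewrite rmorphN rmorphD /= -aE; ring.
  by field.
move=> /(congr1 Im); rewrite mulrC ImZ /= => hh.
have : 0 <= (a + eps) * Im w by rewrite mulr_ge0 // addr_ge0 // ltW.
by rewrite -oppr_le0 -mulNr -hh leNgt eta0.
Qed.

(* The homotopy multiplies [x + i y] by [s]; at [s = 0] the roots in [w] of
   [p (i eta + w e)] are the [- i eta / a], for [a > 0] the roots of [p (e - X)].
   Adding [eps] to the basis vector keeps the degree in [w] equal to [n]. *)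
Lemma garding_step (x y : 'I_n -> R) (eta t : R) : 0 < eta -> 0 <= t ->
  (forall (x : 'I_n -> R) (s : R), 0 <= s <= 1 ->
     ev p (fun i => Complex (x i) (eta + s * y i)) != 0) ->
  ev p (fun i => Complex (x i) (eta + y i + t * e i)) != 0.
Proof.
move=> eta0 t0 IH.
pose u i : C := Complex (x i) (y i).
(* The outer variable is [w], and the coefficients are polynomials in [s]: [G] encodes p (i eta + s
   u + w e). *)
pose G : {poly {poly C}} := mmap (polyC \o (polyC \o real_complex R))
  (fun i => ((Complex 0 eta)%:P + (u i)%:P * 'X)%:P + ((e i)%:C%:P)%:P * 'X) p.
have [sG cG] := mmap_affine (polyC \o real_complex R)
   (fun i => (Complex 0 eta)%:P + (u i)%:P * 'X) (fun i => ((e i)%:C)%:P) homp.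
have cGE : G`_n = (ev p (fun i => (e i)%:C))%:P.
  by rewrite [LHS]cG [RHS]rmorph_mmap.
have lcG : lead_coef G = (ev p (fun i => (e i)%:C))%:P.
  rewrite lead_coefE (_ : (size G).-1 = n) //.
  apply/eqP; rewrite -eqSS prednK.
    rewrite eqn_leq sG ltnNge; apply/negP => /(nth_default 0) /eqP.
    by rewrite cGE polyC_eq0 (negPf e_neq0).
  rewrite lt0n size_poly_eq0; apply: contra_neq e_neq0 => G0.
  by apply/eqP; rewrite -polyC_eq0 -cGE G0 coef0.
have FE (s : R) : map_poly (horner_eval s%:C) G =
    line p (fun i => Complex (s * x i) (eta + s * y i)) (fun i => (e i)%:C).
  rewrite /G rmorph_mmap; apply: eq_mmap => i /=.
    by rewrite map_polyC /= /horner_eval hornerC.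
  rewrite rmorphD rmorphM /= !map_polyC map_polyX /= /horner_eval !hornerE.
  congr (_%:P + _); rewrite mulrC /u.
  by apply/eqP; rewrite eq_complex ReD ImD ReZ ImZ /= add0r !eqxx.
have H0 : lhp_roots (map_poly (horner_eval 0%:C) G).
  rewrite FE => w w0; have := start eta0 w0; rewrite !line_eval.
  apply: contra_neq => <-; apply: eq_ev => i; congr (_ + _).
  by apply/eqP; rewrite eq_complex /= !mul0r addr0 !eqxx.
(* A real [w] only moves the real part of the point, which [IH] leaves arbitrary. *)
have H1 (s r : R) : 0 <= s <= 1 -> (map_poly (horner_eval s%:C) G).[r%:C] != 0.
  move=> hs; rewrite FE line_eval.
  have := IH (fun i => s * x i + e i * r) s hs.
  apply: contra_neq => <-; apply: eq_ev => i.
  by apply/eqP; rewrite eq_complex ReD ImD ReZ ImZ /= mulr0 addr0 !eqxx.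
have t0' : 0 <= Im (Complex 0 t) by [].
have := homotopy_roots lcG e_neq0 H1 H0 t0'; rewrite FE line_eval.
apply: contra_neq => <-; apply: eq_ev => i.
by apply/eqP; rewrite eq_complex ReD ImD ReZ ImZ /= mulr0 !mul1r addr0 [e i * t]mulrC !eqxx.
Qed.
End Step.

(** Coordinates are raised one at a time above a common imaginary part [eta]: [K] allows the first
    [k] of them to be raised, and [garding_step] raises one more. *)
Lemma P_hyperbolic_nonvanishing : nonvanishing p.
Proof.
have K (k : nat) : (k <= n)%N -> forall (x y : 'I_n -> R) (eta : R), 0 < eta ->
    (forall i, 0 <= y i) ->
    ev p (fun i => Complex (x i) (eta + (if (i < k)%N then y i else 0))) != 0.
  elim: k => [_|k IH kn] x y eta eta0 y0.
    have := base x eta0; apply: contra_neq => <-.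
    by apply: eq_ev => i; rewrite ltn0 addr0.
  have [yk|yk] := eqVneq (y (Ordinal kn)) 0.
    have := IH (ltnW kn) x y eta eta0 y0; apply: contra_neq => <-.
    apply: eq_ev => i; rewrite [(i < k.+1)%N]ltnS [(i <= k)%N]leq_eqVlt; case: eqP => //= ik.
    by rewrite ik ltnn (_ : i = Ordinal kn) ?yk //; apply: val_inj.
  have {}yk : 0 < y (Ordinal kn) by rewrite lt0r yk y0.
  (* The move along the shifted basis vector adds [y (Ordinal kn) * eps = eta / 2] to all
     coordinates; this makes up for starting at [eta / 2]. *)
  pose eps := eta / (2 * y (Ordinal kn)).
  have eps0 : 0 < eps by rewrite divr_gt0 // mulr_gt0.
  have eta20 : 0 < eta / 2 by lra.
  have st (x' : 'I_n -> R) (s : R) : 0 <= s <= 1 -> ev p (fun i =>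
      Complex (x' i) (eta / 2 + s * (if (i < k)%N then y i else 0))) != 0.
    move=> /andP[s0 _].
    have := IH (ltnW kn) x' (fun i => s * y i) _ eta20 (fun i => mulr_ge0 s0 (y0 i)).
    apply: contra_neq => <-; apply: eq_ev => i.
    by case: ifP => // _; rewrite mulr0.
  have := @garding_step (Ordinal kn) eps eps0 x _ _ _ eta20 (ltW yk) st.
  apply: contra_neq => <-; apply: eq_ev => i.
  rewrite [(i < k.+1)%N]ltnS [(i <= k)%N]leq_eqVlt.
  have -> : (i == Ordinal kn) = (i == k :> nat) by [].
  have tE : y (Ordinal kn) * eps = eta / 2 by rewrite /eps; field; rewrite gt_eqF.
  have [ik|ik|ik] := ltngtP i k; rewrite /= mulrDr tE; congr Complex.
  - by rewrite mulr0; lra.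
  - by rewrite mulr0; lra.
  by rewrite (_ : i = Ordinal kn) ?mulr1; [lra|exact: val_inj].
move=> z z0.
have [eta eta0 hz] : exists2 eta : R, 0 < eta & forall i, eta <= Im (z i).
  exists (\big[Num.min/1]_i Im (z i)).
    by apply: lt_bigmin.
  by move=> i; apply: bigmin_le_cond.
have y0 i : 0 <= Im (z i) - eta by rewrite subr_ge0.
have := K n (leqnn n) (fun i => Re (z i)) _ eta eta0 y0.
apply: contra_neq => <-; apply: eq_ev => i.
by rewrite ltn_ord addrC subrK; case: (z i).
Qed.

End Garding.

Lemma poly_lim_ge0 (R : realType) (P : {poly R}) :
  (forall t, 0 < t -> 0 <= P.[t]) -> 0 <= P.[0].
Proof.
move=> h; rewrite leNgt; apply/negP => P0.
have e0 : 0 < - P.[0] / 2 by lra.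
have [d d0 hd] := poly_cont (map_poly (real_complex R) P) 0 e0.
have := hd (real_complex R d).
rewrite subr0 cabs_real gtr0_norm // lexx => /(_ isT).
rewrite -[0 in X in cabs X](rmorph0 (real_complex R)) !horner_map -rmorphB cabs_real.
by have := h d d0; have := ler_norm (P.[d] - P.[0]); lra.
Qed.

(* Taking purely imaginary arguments, [im_mono p] says that [p] is nondecreasing
   on the positive orthant. *)
Lemma im_mono_coef_ge0 (R : realType) (n d : nat) (p : {mpoly R[n]}) :
  p \is d.-homog -> im_mono p -> (forall x, (forall i, 0 < x i) -> 0 <= p.@[x]) ->
  forall m, 0 <= p@_m.
Proof.
elim: d p => [|d IH] p hp mono pos m.
  have [->|m0] := eqVneq m 0%MM; last first.
    by rewrite (dhomog_nemf_coeff hp) ?lexx //= mdeg_eq0.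
  have := pos (fun=> 1) (fun=> ltr01).
  have -> : p = (p@_0)%:MP; last by rewrite mevalC mcoeffC eqxx mulr1.
  apply/mpolyP => m'; rewrite mcoeffC; case: eqVneq => [<-|m0]; first by rewrite mulr1.
  by rewrite mulr0; apply: (dhomog_nemf_coeff hp); rewrite /= mdeg_eq0.
have [m0|m0] := eqVneq (mdeg m) d.+1; last by rewrite (dhomog_nemf_coeff hp) ?lexx.
have [j mj] : exists j, (0 < m j)%N.
  apply/existsP; apply: contra_eqT m0; rewrite negb_exists => /forallP h0.
  by rewrite mdegE big1 // => i _; have := h0 i; rewrite lt0n negbK => /eqP.
have [p0|p0] := eqVneq p 0; first by rewrite p0 mcoeff0.
have nv := mono_nonvanishing hp mono p0.
have D0 : 0 <= (p^`M(j))@_(m - U_(j)).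
  have [->|nvD] := nonvanishing_mderiv j hp nv; first by rewrite mcoeff0.
  apply: IH; first exact: dhomog_mderiv.
    exact: nonvanishing_mono.
  move=> x x0.
  have incr (u v : 'I_n -> R) : (forall i, 0 < u i <= v i) -> p.@[u] <= p.@[v].
    move=> h; have pu : 0 <= p.@[u] by apply: pos => i; have := h i; lra.
    have pv : 0 <= p.@[v] by apply: pos => i; have := h i; lra.
    have := mono (fun i => 'i%C * (real_complex R (u i)))
                 (fun i => 'i%C * (real_complex R (v i))).
    rewrite !(evZ _ _ hp) !ev_real !cabsM !cabs_real !ger0_norm //.
    have ci : cabs ('i%C ^+ d.+1 : R[i]) = 1.
      by rewrite cabsX /cabs /= expr0n add0r expr1n sqrtr1 expr1n.
    rewrite ci !mul1r; apply=> i; rewrite ![_ * real_complex R _]mulrC !ReZ !ImZ /=.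
    by rewrite !mulr0 !mulr1; have := h i; lra.
  pose L : {poly R} := mmap polyC (fun i => (x i)%:P + (i == j)%:R%:P * 'X) p.
  have LE t : L.[t] = p.@[fun i => x i + (i == j)%:R * t].
    rewrite -[LHS]/(horner_eval t _) rmorph_mmap.
    by apply: eq_mmap => i /=; rewrite /horner_eval !hornerE.
  have LC : map_poly (real_complex R) L = line p (fun i => real_complex R (x i)) (unit_dir R j).
    rewrite [LHS]rmorph_mmap; apply: eq_mmap => i /=; first by rewrite map_polyC.
    by rewrite rmorphD rmorphM /= !map_polyC map_polyX /= rmorph_nat.
  have <- : L^`().[0] = p^`M(j).@[x].
    apply: (@complexI R); rewrite -ev_real -horner_map rmorph0 -deriv_map LC line_deriv.
    by rewrite line_eval; apply: eq_ev => i; rewrite mulr0 addr0.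
  (* [Q] is the difference quotient of [L] at 0, nonnegative for positive arguments; its value at 0
     is the derivative. *)
  have /factor_theorem[Q LQ] : root (L - L.[0]%:P) 0 by rewrite rootE !hornerE subrr.
  have -> : L^`() = (L - L.[0]%:P)^`() by rewrite derivB derivC subr0.
  rewrite LQ derivM derivXsubC mulr1 hornerD hornerM hornerXsubC subrr mulr0 add0r.
  apply: poly_lim_ge0 => t t0.
  have := congr1 (horner^~ t) LQ; rewrite !hornerE subr0 => QE.
  rewrite -(pmulr_lge0 _ t0) -QE subr_ge0 !LE; apply: incr => i.
  by rewrite mulr0 addr0 x0 lerDl mulr_ge0 // ltW.
have := D0; rewrite mcoeff_deriv submK ?lep1mP ?lt0n_neq0 //.
by rewrite pmulrn_lge0.
Qed.

(** * The exchange property of the support *)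

Section RealRooted.
Variable R : realType.
Local Notation C := R[i].
Local Notation "x %:C" := (real_complex R x) (format "x %:C").

(** The coefficients are the elementary symmetric functions of [r], and each monomial of e_N occurs
    in the expansion of e_1 ^ N. *)
Lemma prod_1DX_coef (r : seq R) (N : nat) : all (>= 0) r ->
  let T : {poly R} := \prod_(a <- r) (1 + a *: 'X) in
  T`_0 = 1 /\ 0 <= T`_N <= T`_1 ^+ N.
Proof.
elim: r N => [|a r IH] N /=.
  rewrite big_nil !coef1 eqxx; case: N => [|N]; rewrite ?expr0 ?lexx ?ler01 //.
  by rewrite expr0n /= lexx.
move=> /andP[a0 r0]; rewrite big_cons; set T := \prod_(_ <- r) _.
have E k : ((1 + a *: 'X) * T)`_k = T`_k + (if k is k'.+1 then a * T`_k' else 0).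
  by rewrite mulrDl mul1r coefD -scalerAl coefZ coefXM; case: k; rewrite ?mulr0.
have [T0 _] := IH 0%N r0; have T1 : 0 <= T`_1 by have [_ /andP[]] := IH 1%N r0.
rewrite !E T0 addr0 mulr1; split=> //.
case: N => [|N]; first by rewrite T0 addr0 expr0 ler01 lexx.
have [_ /andP[h1 h2]] := IH N.+1 r0; have [_ /andP[h3 h4]] := IH N r0.
rewrite addr_ge0 ?mulr_ge0 //=.
apply: (@le_trans _ _ ((T`_1 + a) * T`_1 ^+ N)).
  by rewrite mulrDl -exprS lerD // ler_wpM2l.
rewrite exprS ler_wpM2l ?addr_ge0 // lerXn2r ?nnegrE ?addr_ge0 //.
by rewrite lerDl.
Qed.

(* All roots of [Q] are negative, hence [Q / Q`_0] is a product of factors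
   [1 + a X] with [a > 0]. *)
Lemma uhp_coef_bound (Q : {poly R}) (N : nat) : uhp (map_poly (real_complex R) Q) ->
  (forall k, 0 <= Q`_k) -> 0 < Q`_0 -> Q`_N * Q`_0 ^+ N <= Q`_1 ^+ N * Q`_0.
Proof.
move=> hQ Qge0 Q0.
have Qpos x : 0 <= x -> 0 < Q.[x].
  move=> x0; rewrite horner_coef.
  have : (0 < size Q)%N.
    by rewrite lt0n size_poly_eq0; apply: contraTneq Q0 => ->; rewrite coef0 ltxx.
  case: (size Q) => // k _; rewrite big_ord_recl expr0 mulr1 ltr_wpDr //.
  by apply: sumr_ge0 => i _; rewrite mulr_ge0 ?exprn_ge0.
have [r Er] := closed_field_poly_normal (map_poly (real_complex R) Q).
have realr a : a \in r -> a = (complex.Re a)%:C /\ complex.Re a < 0.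
  move=> ar; have ra : root (map_poly (real_complex R) Q) a.
    by rewrite Er rootE hornerZ horner_prod (big_rem a) //= hornerXsubC subrr mul0r mulr0.
  have I1 : complex.Im a <= 0.
    by rewrite leNgt; apply/negP => /hQ; rewrite -rootE ra.
  (* The coefficients are real: the conjugate of a root below the real axis would be a root above
     it. *)
  have I2 : 0 <= complex.Im a.
    rewrite leNgt; apply/negP => I2.
    have /hQ : 0 < complex.Im (conjc a) by case: (a) I2 => x y /=; rewrite oppr_gt0.
    rewrite -rootE -complex_root_conj.
    rewrite (_ : map_poly _ _ = map_poly (real_complex R) Q) ?ra //.
    by apply/polyP => k; rewrite !coef_map /= oppr0.
  have aE : a = (complex.Re a)%:C.
    by case: (a) I1 I2 => x y /= I1 I2; congr Complex; lra.
  split=> //; rewrite ltNge; apply/negP => /Qpos.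
  by move: ra; rewrite aE rootE horner_map fmorph_eq0 => /eqP ->; rewrite ltxx.
pose s := [seq - (complex.Re a)^-1 | a <- r].
have s0 : all (>= 0) s.
  apply/allP => _ /mapP[a /realr[_ a0] ->].
  by rewrite oppr_ge0 invr_le0 ltW.
have [c QE] : exists c : R, Q = c *: \prod_(a <- s) (1 + a *: 'X).
  exists (lead_coef Q * \prod_(a <- r) (- complex.Re a)).
  apply: (@map_poly_inj _ _ (real_complex R)); rewrite Er lead_coef_map /=.
  rewrite -[in RHS]mul_polyC rmorphM /= map_polyC /= rmorphM polyCM -mulrA mul_polyC.
  congr (_ *: _); rewrite !rmorph_prod /s big_map -big_split /=.
  rewrite big_seq [RHS]big_seq; apply: eq_bigr => a /realr[aE a0].
  rewrite rmorphD rmorph1 -mul_polyC rmorphM /= map_polyC map_polyX /= mulrDr mulr1 mulrA.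
  rewrite -polyCM -rmorphM /= mulrNN divff ?lt_eqF // rmorph1 mul1r addrC; congr (_ + _).
  by rewrite rmorphN /= -aE polyCN.
have [T0 /andP[_ TN]] := prod_1DX_coef N s0.
have c0 : Q`_0 = c by rewrite QE coefZ T0 mulr1.
rewrite c0 in Q0; rewrite QE !coefZ T0 mulr1 exprMn.
rewrite [leLHS](_ : _ = c ^+ N * c * (\prod_(a <- s) (1 + a *: 'X))`_N); last by ring.
rewrite [leRHS](_ : _ = c ^+ N * c * (\prod_(a <- s) (1 + a *: 'X))`_1 ^+ N); last by ring.
by rewrite ler_wpM2l // mulr_ge0 ?exprn_ge0 ?ltW.
Qed.
End RealRooted.

Definition wt (n : nat) (S : {set 'I_n}) (m : 'X_{1..n}) : nat := \sum_(i in S) m i.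

Section Exchange.
Variables (R : realType) (n : nat).
Local Notation C := R[i].
Local Notation "x %:C" := (real_complex R x) (format "x %:C").

(** With [im_mono] the zero polynomial qualifies, so derivatives never leave the class. *)
Definition stable (d : nat) (p : {mpoly R[n]}) : Prop :=
  [/\ p \is d.-homog, im_mono p & forall m, 0 <= p@_m].

Lemma stable_mderiv d p j : stable d.+1 p -> stable d p^`M(j).
Proof.
move=> [hp mono p0]; split.
- exact: dhomog_mderiv.
- have [->|pn0] := eqVneq p 0; first by rewrite mderiv0 => z w _; rewrite /ev !mmap0 lexx.
  have [->|] := nonvanishing_mderiv j hp (mono_nonvanishing hp mono pn0).
    by move=> z w _; rewrite /ev !mmap0 lexx.
  exact: nonvanishing_mono.
by move=> m; rewrite mcoeff_deriv mulrn_wge0.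
Qed.

(** What is left to show is the sign of [p] on the positive orthant. By homogeneity a zero there
    would give a zero with purely imaginary coordinates; as [p] is positive at (1, ..., 1), the
    intermediate value theorem on a segment forbids negative values. *)
Lemma P_hyperbolic_stable p : P_hyperbolic p -> stable n p.
Proof.
move=> hyp; have nv := P_hyperbolic_nonvanishing hyp.
case: hyp => hp _ p1 _; have mono := nonvanishing_mono nv.
split=> //; apply: (im_mono_coef_ge0 hp mono) => x x0.
have nz y : (forall i, 0 < y i) -> p.@[y] != 0.
  move=> y0; have := nv (fun i => 'i%C * (y i)%:C).
  rewrite (evZ _ _ hp) ev_real mulf_eq0 negb_or fmorph_eq0 => h.
  by have /andP[] := h (fun i => ltac:(rewrite mulrC ImZ /= mulr1; exact: y0)).
pose L : {poly R} := mmap polyC (fun i => 1%:P + (x i - 1)%:P * 'X) p.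
have LE t : L.[t] = p.@[fun i => 1 + (x i - 1) * t].
  rewrite -[LHS]/(horner_eval t _) rmorph_mmap.
  by apply: eq_mmap => i /=; rewrite /horner_eval !hornerE.
rewrite leNgt; apply/negP => px.
have L0 : 0 < L.[0] by rewrite LE (@meval_eq _ _ _ (fun=> 1)) // => i; rewrite mulr0 addr0.
have L1 : L.[1] < 0 by rewrite LE (@meval_eq _ _ _ x) // => i; rewrite mulr1 addrC subrK.
have [|t /andP[t0 t1]] := @poly_ivt R (- L) 0 1 ler01.
  by rewrite !hornerN oppr_le0 oppr_ge0 !ltW.
rewrite rootN rootE LE => /eqP h; have := nz (fun i => 1 + (x i - 1) * t).
rewrite h eqxx => /(_ _)/negP[] // i; have := x0 i; nra.
Qed.

Variables (d : nat) (p : {mpoly R[n]}).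
Hypothesis stp : stable d p.

Section Univariate.
Variables (U S D : {set 'I_n}).
Hypothesis SD : [disjoint S & D].
Variable A : R.

(* [p] at [A] on [S], at ['X] on [D], at 1 elsewhere on [U] and at 0 off [U]. *)
Definition probe_base (i : 'I_n) : R :=
  if (i \in U) && (i \notin D) then (if i \in S then A else 1) else 0.
Definition probe_dir (i : 'I_n) : R := ((i \in U) && (i \in D))%:R.
Definition probe : {poly R} :=
  mmap polyC (fun i => (probe_base i)%:P + (probe_dir i)%:P * 'X) p.

Lemma probe_coef k : probe`_k = \sum_(m <- msupp p | (wt (~: U) m == 0)%N && (wt D m == k))
  p@_m * A ^+ wt S m.
Proof.
rewrite /probe /mmap coef_sum [RHS]big_mkcond; apply: eq_bigr => m _ /=.
rewrite coefCM; suff -> : mmap1 (fun i => (probe_base i)%:P + (probe_dir i)%:P * 'X) m =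
    if wt (~: U) m == 0%N then (A ^+ wt S m) *: 'X^(wt D m) else 0.
  case: ifP; rewrite ?coef0 ?mulr0 //= => _; rewrite coefZ coefXn eq_sym.
  by case: eqP; rewrite ?mulr1 ?mulr0.
rewrite /mmap1; case: ifPn => [/eqP|].
  move=> /eqP; rewrite sum_nat_eq0 => /forallP U0.
  rewrite -mul_polyC !rmorphXn /= -!prodrXr.
  rewrite /wt [X in X * _]big_mkcond [X in _ * X]big_mkcond -big_split /=.
  apply: eq_bigr => i _; have := U0 i; rewrite inE /probe_base /probe_dir.
  have [iU _|_ /eqP ->] := boolP (i \in U) => /=; last first.
    by rewrite !expr0; case: ifP; case: ifP; rewrite mulr1.
  have [iD|iD] := boolP (i \in D).
    by rewrite (disjointFl SD iD) mul1r add0r mul1r.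
  by rewrite mul0r addr0 mulr1; case: ifP; rewrite // expr1n.
move=> w0; have [i /andP[]] : exists i, (i \in ~: U) && (m i != 0)%N.
  apply/existsP; apply: contraR w0; rewrite negb_exists => /forallP h.
  rewrite sum_nat_eq0; apply/forallP => i; rewrite implybE.
  by have := h i; rewrite negb_and negbK.
rewrite inE => iU mi.
rewrite (bigD1 i) //= /probe_base /probe_dir (negPf iU) /= mul0r addr0.
by rewrite expr0n (negPf mi) mul0r.
Qed.

(** Coordinates outside [D] are real, where [nonvanishing] says nothing. By [im_mono] a zero at [w]
    spreads to the whole vertical segment below it, which forces the polynomial to be 0. *)
Lemma probe_uhp : probe != 0 -> uhp (map_poly (real_complex R) probe).
Proof.
have E : map_poly (real_complex R) probe =
   line p (fun i => (probe_base i)%:C) (fun i => (probe_dir i)%:C).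
  rewrite [LHS]rmorph_mmap; apply: eq_mmap => i /=; first by rewrite map_polyC.
  by rewrite rmorphD rmorphM /= !map_polyC map_polyX.
move=> P0 w w0; apply: contra P0 => /eqP Pw.
rewrite -(map_poly_eq0 (real_complex R)); apply/eqP.
apply: (poly_vertical0 (x := complex.Re w) w0) => s hs.
apply/eqP; rewrite -cabs_eq0 eq_le cabs_ge0 andbT -[leRHS](cabs0 R) -Pw E !line_eval.
case: stp => _ mono _; apply: mono => i.
rewrite !ReD !ImD !ReZ !ImZ /=; split=> //; rewrite /probe_dir.
by case: ((i \in U) && (i \in D)) => /=; lra.
Qed.
End Univariate.

Lemma uhp_derivn (P : {poly C}) k l : uhp P -> P`_l != 0 -> (k <= l)%N -> uhp P^`(k).
Proof.
move=> hP Pl; elim: k => [|k IH] kl; first by rewrite derivn0.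
rewrite derivnS; apply: uhp_deriv (IH (ltnW kl)) _.
rewrite ltnNge; apply/negP => sP.
have : (P^`(k))`_(l - k) = 0 by rewrite nth_default // (leq_trans sP) // subn_gt0.
rewrite coef_derivn subnKC ?(ltnW kl) // => /eqP.
by rewrite mulrn_eq0 (negPf Pl) orbF -leqn0 leqNgt ffact_gt0 (ltnW kl).
Qed.

(* The restriction of [p] to [A 1_S + X 1_D + 1] is real-rooted; applying
   [uhp_coef_bound] to its derivative of order [wt D m1] and letting [A] grow
   compares degrees in [A]. *)
Lemma exchange (U S D : {set 'I_n}) (m1 m2 : 'X_{1..n}) : [disjoint S & D] ->
  m1 \in msupp p -> wt (~: U) m1 = 0%N -> m2 \in msupp p -> wt (~: U) m2 = 0%N ->
  (wt D m1 < wt D m2)%N ->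
  exists m, [/\ m \in msupp p, wt (~: U) m = 0%N, wt D m = (wt D m1).+1
    & ((wt D m2 - wt D m1).-1 * wt S m1 + wt S m2 <= (wt D m2 - wt D m1) * wt S m)%N].
Proof.
move=> SD m1p U1 m2p U2 lt12.
have [hp _ p0] := stp.
set k1 := wt D m1 in lt12 *; set k2 := wt D m2 in lt12 *; set N := (k2 - k1)%N.
set W := (_ * _ + _)%N.
have N0 : (0 < N)%N by rewrite subn_gt0.
pose good m := [&& wt (~: U) m == 0%N, wt D m == k1.+1 & (W <= N * wt S m)%N].
have [/hasP[m mp /and3P[/eqP h1 /eqP h2 h3]]|/hasPn H] := boolP (has good (msupp p)).
  by exists m.
exfalso.
pose c k A := (probe U S D A)`_k.
have c_ge0 k A : 0 <= A -> 0 <= c k A.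
  move=> A0; rewrite /c probe_coef // sumr_ge0 // => m _.
  by rewrite mulr_ge0 ?exprn_ge0.
have c_ge m A : 0 <= A -> m \in msupp p -> wt (~: U) m = 0%N ->
    p@_m * A ^+ wt S m <= c (wt D m) A.
  move=> A0 mp Um; rewrite /c probe_coef // big_mkcond.
  rewrite (bigD1_seq m) ?msupp_uniq //= Um !eqxx /=.
  by rewrite lerDl sumr_ge0 // => m' _; case: ifP => // _; rewrite mulr_ge0 ?exprn_ge0.
have pm m : m \in msupp p -> 0 < p@_m.
  by rewrite mcoeff_msupp lt0r p0 andbT.
pose K := \sum_(m <- msupp p) p@_m.
have K0 : 0 <= K by apply: sumr_ge0.
(* Without the desired [m], the exponents of [A] in this coefficient satisfy [N * wt S m < W]. The
   factor [A] on the left avoids writing [W - 1], which truncates for [W = 0]; in that case the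
   coefficient is 0. *)
have c_le A : 1 <= A -> c k1.+1 A ^+ N * A <= K ^+ N * A ^+ W.
  move=> A1; have A0 : 0 <= A := le_trans ler01 A1.
  have [W0|W0] := posnP W.
    have -> : c k1.+1 A = 0.
      rewrite /c probe_coef // big_seq_cond big1 // => m /andP[/H].
      rewrite /good W0 leq0n andbT.
      by move/negPf ->.
    by rewrite expr0n eqn0Ngt N0 mul0r mulr_ge0 ?exprn_ge0.
  pose e := (W.-1 %/ N)%N.
  have cK : c k1.+1 A <= K * A ^+ e.
    rewrite /c probe_coef // /K mulr_suml big_mkcond big_seq [leRHS]big_seq.
    apply: ler_sum => m mp; case: ifPn => h; last by rewrite mulr_ge0 ?exprn_ge0.
    rewrite ler_wpM2l // ler_weXn2l // /e leq_divRL // mulnC.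
    have := H m mp; rewrite /good andbA h /= -ltnNge; lia.
  apply: (@le_trans _ _ ((K * A ^+ e) ^+ N * A)).
    rewrite ler_wpM2r // lerXn2r ?nnegrE ?c_ge0 // mulr_ge0 ?exprn_ge0 //.
  rewrite exprMn -mulrA ler_wpM2l ?exprn_ge0 // -exprM -exprSr ler_weXn2l //.
  by have := leq_trunc_div W.-1 N; rewrite -/e; lia.
(* The factor that [k1] derivations put on the coefficient of index [k1.+1]; the factors at [k1] and
   [k2] are at least 1 and are dropped. *)
pose F : R := (k1.+1 ^_ k1)%:R.
have key A : 1 <= A -> p@_m1 ^+ N.-1 * p@_m2 * A ^+ W <= F ^+ N * c k1.+1 A ^+ N.
  move=> A1; have Ap : 0 < A := lt_le_trans ltr01 A1; have A0 := ltW Ap.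
  have g1 := c_ge _ _ A0 m1p U1; have g2 := c_ge _ _ A0 m2p U2.
  have q1 : 0 < p@_m1 * A ^+ wt S m1 by rewrite mulr_gt0 ?pm // exprn_gt0.
  have q2 : 0 < p@_m2 * A ^+ wt S m2 by rewrite mulr_gt0 ?pm // exprn_gt0.
  have ck1 : 0 < c k1 A by exact: lt_le_trans g1.
  have ck2 : 0 < c k2 A by exact: lt_le_trans g2.
  pose Q := (probe U S D A)^`(k1).
  have hQ : uhp (map_poly (real_complex R) Q).
    rewrite /Q -derivn_map; apply: (uhp_derivn (l := k2)); last exact: ltnW.
      by apply: probe_uhp => //; apply: contraTneq ck1 => P0; rewrite /c P0 coef0 ltxx.
    by rewrite coef_map fmorph_eq0 gt_eqF.
  have Qc j : Q`_j = c (k1 + j)%N A *+ (k1 + j) ^_ k1 by rewrite /Q coef_derivn.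
  have Q0 : c k1 A <= Q`_0.
    by rewrite Qc addn0 -[leLHS]mulr1n ler_wpMn2l ?ltW // ffact_gt0 leqnn.
  have QN : c k2 A <= Q`_N.
    rewrite Qc subnKC ?(ltnW lt12) // -[leLHS]mulr1n ler_wpMn2l ?ltW //.
    by rewrite ffact_gt0 ltnW.
  have Q1 : Q`_1 = F * c k1.+1 A by rewrite Qc addn1 mulr_natl.
  have Qge j : 0 <= Q`_j by rewrite Qc mulrn_wge0 ?c_ge0.
  have := uhp_coef_bound N hQ Qge (lt_le_trans ck1 Q0).
  rewrite (_ : Q`_0 ^+ N = Q`_0 ^+ N.-1 * Q`_0); last by rewrite -exprSr prednK.
  rewrite mulrA ler_pM2r ?(lt_le_trans ck1 Q0) // Q1 exprMn.
  apply: le_trans.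
  rewrite [leLHS](_ : _ = (p@_m2 * A ^+ wt S m2) * (p@_m1 * A ^+ wt S m1) ^+ N.-1).
    apply: ler_pM; rewrite ?exprn_ge0 ?(ltW q1) ?(ltW q2) ?(le_trans g2) //.
    by rewrite lerXn2r ?nnegrE ?(ltW q1) ?(le_trans g1) ?(le_trans (ltW ck1)).
  by rewrite /W exprD exprMn -exprM [(_ * wt _ _)%N]mulnC; ring.
pose a := p@_m1 ^+ N.-1 * p@_m2.
have a0 : 0 < a by rewrite mulr_gt0 ?exprn_gt0 ?pm.
(* Makes [a * A] exceed [F ^+ N * K ^+ N] by [a], against [key] and [c_le] combined. *)
pose A := F ^+ N * K ^+ N / a + 1.
have A1 : 1 <= A by rewrite lerDr divr_ge0 ?mulr_ge0 ?exprn_ge0 // ltW.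
have AW : 0 < A ^+ W by rewrite exprn_gt0 // (lt_le_trans ltr01).
have : a * A ^+ W * A <= F ^+ N * (K ^+ N * A ^+ W).
  apply: (@le_trans _ _ (F ^+ N * (c k1.+1 A ^+ N * A))); last first.
    by rewrite ler_wpM2l ?c_le // exprn_ge0.
  by rewrite mulrA ler_wpM2r ?key // (le_trans ler01).
rewrite mulrAC mulrA ler_pM2r // /A mulrDr mulr1 mulrCA divff ?gt_eqF // mulr1.
by rewrite leNgt ltrDl a0.
Qed.
End Exchange.

(** * The rank function of a support and its submodularity *)

Section Rank.
Variable n : nat.
Implicit Types (S T D U : {set 'I_n}) (m : 'X_{1..n}) (J : seq 'X_{1..n}).

Definition rk J S : nat := \max_(m <- J) wt S m.

Lemma wt_rk J S m : m \in J -> (wt S m <= rk J S)%N.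
Proof. by move=> mJ; exact: leq_bigmax_seq. Qed.

Lemma wtU S T m : [disjoint S & T] -> wt (S :|: T) m = (wt S m + wt T m)%N.
Proof. by move=> h; rewrite /wt -bigU //; apply: eq_bigl => i; rewrite !inE. Qed.

Lemma wt_sub S T m : S \subset T -> wt T m = (wt S m + wt (T :\: S) m)%N.
Proof. by move=> /setIidPr ST; rewrite /wt (big_setID S) /= ST. Qed.

Lemma wt1 i m : wt [set i] m = m i.
Proof. by rewrite /wt big_set1. Qed.

Lemma wtT m : wt setT m = mdeg m.
Proof. by rewrite /wt mdegE; apply: eq_bigl => i; rewrite inE. Qed.

Lemma rk_attained J S : J != [::] -> exists2 m, m \in J & wt S m = rk J S.
Proof.
elim: J => // m J IH _; rewrite /rk big_cons -/(rk J S).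
have [->|/IH[m' m'J e]] := eqVneq J [::].
  by exists m; rewrite ?inE ?eqxx // /rk big_nil maxn0.
have [h|h] := leqP (wt S m) (rk J S).
  by exists m'; rewrite ?inE ?m'J ?orbT // e.
by exists m; rewrite ?inE ?eqxx.
Qed.

(** Cleared of denominators, the last inequality places [wt S m] on or above the chord from
    ([wt D m1], [wt S m1]) to ([wt D m2], [wt S m2]), one unit to the right of its left end. *)
Definition exchangeable J := forall S D m1 m2, [disjoint S & D] ->
  m1 \in J -> m2 \in J -> (wt D m1 < wt D m2)%N ->
  exists m, [/\ m \in J, wt D m = (wt D m1).+1
    & ((wt D m2 - wt D m1).-1 * wt S m1 + wt S m2 <= (wt D m2 - wt D m1) * wt S m)%N].

Section Exchangeable.
Variable J : seq 'X_{1..n}.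
Hypotheses (exJ : exchangeable J) (J0 : J != [::]).

(** Among the maximizers of [wt S], let [m1] have the largest weight on [T :\: S], and suppose [m2]
    beats it on [T]. The exchange raises the weight on [T :\: S] by 1. Either [wt S] stays maximal,
    against the choice of [m1], or the chord inequality forces [wt T m2 <= wt T m1]. *)
Lemma rk_chain S T : S \subset T ->
  exists m, [/\ m \in J, wt S m = rk J S & wt T m = rk J T].
Proof.
move=> ST; pose JS := [seq m <- J | wt S m == rk J S].
have JS0 : JS != [::].
  have [m mJ e] := rk_attained S J0; rewrite -has_filter; apply/hasP.
  by exists m; rewrite ?e.
have [m1 + d1] := rk_attained (T :\: S) JS0.
rewrite mem_filter => /andP[/eqP s1 m1J].
exists m1; split=> //; apply/eqP; rewrite eqn_leq wt_rk //= leqNgt; apply/negP => lt.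
have [m2 m2J t2] := rk_attained T J0.
have := wt_rk S m2J; have := wt_sub m1 ST; have := wt_sub m2 ST => e2 e1 s2.
have dlt : (wt (T :\: S) m1 < wt (T :\: S) m2)%N by lia.
have SD : [disjoint S & T :\: S] by rewrite disjoint_sym disjoints_subset setDE subsetIr.
have [m [mJ dm]] := exJ SD m1J m2J dlt.
set N := (wt _ m2 - _)%N => h.
have NE : (wt (T :\: S) m2 = wt (T :\: S) m1 + N)%N by rewrite /N; lia.
 have hm := wt_rk S mJ.
have [sm|sm] := eqVneq (wt S m) (rk J S).
  have : m \in JS by rewrite mem_filter sm eqxx.
  by move=> /(wt_rk (T :\: S)); rewrite dm -d1 ltnn.
have r0 : (0 < rk J S)%N by lia.
have {}sm : (wt S m <= (rk J S).-1)%N by lia.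
have N0 : (0 < N)%N by rewrite /N; lia.
have : (N * wt S m <= N * (rk J S).-1)%N by rewrite leq_mul2l sm orbT.
rewrite s1 in h.
have -> : (N * (rk J S).-1 = N.-1 * rk J S + rk J S - N)%N by nia.
have : (N <= N.-1 * rk J S + rk J S)%N by nia.
by move: h; set a := (N.-1 * _)%N; set b := (N * _)%N; lia.
Qed.

(** The weight of a single vector is modular; [rk_chain] supplies one attaining the ranks of both
    intersection and union. *)
Lemma rk_submod S T : (rk J (S :&: T) + rk J (S :|: T) <= rk J S + rk J T)%N.
Proof.
have sub : S :&: T \subset S :|: T by rewrite subIset // subsetUl.
have [m [mJ e1 e2]] := rk_chain sub.
have : (wt (S :&: T) m + wt (S :|: T) m = wt S m + wt T m)%N.
  rewrite (wt_sub m (subsetUl S T)) (wt_sub m (subsetIr S T)).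
  have -> : (S :|: T) :\: S = T :\: (S :&: T).
    by apply/setP => i; rewrite !inE; case: (i \in S); case: (i \in T).
  by lia.
by rewrite e1 e2 => ->; rewrite leq_add ?wt_rk.
Qed.

End Exchangeable.
End Rank.

(** * The rank condition for the all-ones vector, and the equivalence of the two problems *)

Section Ones.
Variables (R : realType) (n : nat).

Definition supp_in (U : {set 'I_n}) (p : {mpoly R[n]}) : seq 'X_{1..n} :=
  [seq m <- msupp p | wt (~: U) m == 0%N].

Lemma stable_exchangeable d (p : {mpoly R[n]}) U : stable d p -> exchangeable (supp_in U p).
Proof.
move=> stp S D m1 m2 SD; rewrite !mem_filter => /andP[/eqP u1 h1] /andP[/eqP u2 h2] lt.
have [m [h u e l]] := exchange stp SD h1 u1 h2 u2 lt.
by exists m; rewrite mem_filter h u eqxx.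
Qed.

Definition indic (U : {set 'I_n}) : 'X_{1..n} := [multinom (i \in U : nat) | i < n].

(* Induction on [U]: for [b] in [U], the hypothesis on the ranks passes to
   [p^`M(b)] and [U :\ b]. *)
Lemma indic_supp (U : {set 'I_n}) (p : {mpoly R[n]}) :
  stable #|U| p -> supp_in U p != [::] ->
  (forall S : {set 'I_n}, S \subset U -> (#|S| <= rk (supp_in U p) S)%N) -> indic U \in msupp p.
Proof.
elim: {U}#|U| {-2}U (erefl #|U|) p => [|k IH] U cU p stp J0 hS.
  have U0 : U = set0 by apply/eqP; rewrite -cards_eq0 cU.
  have [m] : exists m, m \in supp_in U p.
    by case: (supp_in U p) J0 => // m s _; exists m; rewrite inE eqxx.
  rewrite mem_filter => /andP[_ mp]; case: stp => /dhomogP/(_ m mp) h _ _.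
  suff -> : indic U = m by [].
  have /eqP : mdeg m = 0%N by rewrite -cU; exact: h.
  rewrite mdeg_eq0 => /eqP ->; apply/mnmP => i.
  by rewrite mnmE U0 inE mnm0E.
have [b bU] : exists b, b \in U by apply/set0Pn; rewrite -cards_eq0 cU.
pose V := U :\ b; have cV : #|V| = k by move: cU; rewrite (cardsD1 b) bU => -[].
have exJ := stable_exchangeable (U := U) stp; set J := supp_in U p in exJ J0 hS.
have wU m : m \in J -> wt U m = k.+1.
  rewrite mem_filter => /andP[/eqP u mp]; have := wtT m.
  rewrite (wt_sub m (subsetT U)) setTD u addn0 => ->.
  by rewrite -cU; case: stp => /dhomogP/(_ m mp).
have bV : b \notin V by rewrite !inE eqxx.
(* Exponent exactly 1 at [b] is what puts [m - U_(b)] in the support of the derivative over [V],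
   with the same weight on [S]. *)
have step (S : {set 'I_n}) : S \subset V ->
    exists m, [/\ m \in J, m b = 1%N & (#|S| <= wt S m)%N].
  move=> SV; have SU := subset_trans SV (subsetDl U [set b]).
  have bS : b \notin S by apply: contra bV; apply: subsetP.
  have Sb : [disjoint S & [set b]] by rewrite disjoint_sym disjoints1.
  have sSb : S \subset b |: S by rewrite subsetUr.
  have SbU : b |: S \subset U by rewrite subUset sub1set bU.
  have cSb : #|b |: S| = #|S|.+1 by rewrite cardsU1 bS.
  have wtb m : wt (b |: S) m = (m b + wt S m)%N.
    by rewrite wtU ?wt1 // disjoints1.
  have r1 := hS _ SU; have r2 := hS _ SbU; rewrite cSb in r2.
  have [m1 [m1J s1 v1]] := rk_chain exJ J0 SV.
  have m1b : (m1 b <= 1)%N.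
    have := hS V (subsetDl U [set b]); rewrite -v1 cV; have := wU m1 m1J.
    by rewrite (wt_sub m1 (_ : [set b] \subset U)) ?sub1set // wt1 -/V; clear; lia.
  have [m1b1|m1b1] := eqVneq (m1 b) 1%N; first by exists m1; rewrite s1.
  have {m1b1}m1b : m1 b = 0%N by move: (m1 b) m1b m1b1 => [|[|c]].
  (* The exchange goes from [m1], with exponent 0 at [b], towards [m2] and stops at exponent 1; the
     numerical hypothesis says that the chord has height at least [#|S|] there. *)
  have go m2 : m2 \in J -> (0 < m2 b)%N ->
      ((m2 b) * #|S| <= (m2 b).-1 * rk J S + wt S m2)%N ->
      exists m, [/\ m \in J, m b = 1%N & (#|S| <= wt S m)%N].
    move=> m2J m2b h; have := exJ S [set b] m1 m2 Sb m1J m2J.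
    rewrite !wt1 m1b subn0 => /(_ m2b)[m [mJ mb hm]]; exists m; split; rewrite -?wt1 //.
    by rewrite s1 in hm; rewrite -(leq_pmul2l m2b) (leq_trans h).
  have [m2 [m2J s2 t2]] := rk_chain exJ J0 sSb.
  rewrite wtb in t2.
  have [m2b|m2b] := posnP (m2 b); last first.
    by apply: (go m2) => //; rewrite s2 -mulSnr prednK // leq_mul2l r1 orbT.
  (* Here [b] does not raise the rank, so [rk J S] exceeds [#|S|]. A vector attaining the ranks of
     [[set b]] and [b |: S] loses on [S] only its exponent at [b], which leaves the chord high
     enough. *)
  have bSb : [set b] \subset b |: S by rewrite subsetUl.
  have [m3 [m3J s3 t3]] := rk_chain exJ J0 bSb.
  rewrite wt1 wtb in s3 t3.
  have : (1 <= rk J [set b])%N by have := hS [set b]; rewrite sub1set cards1; apply.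
  rewrite -s3 => m3b; apply: (go m3) => //.
  have rE : rk J (b |: S) = rk J S by rewrite -t2 m2b s2.
  rewrite rE in t3 r2; move: (m3 b) (wt S m3) (rk J S) t3 r2 m3b => x y r; clear; nia.
have st' : stable #|V| p^`M(b) by rewrite cV; apply: stable_mderiv; rewrite -cU.
have lift m : m \in J -> m b = 1%N -> (m - U_(b))%MM \in supp_in V p^`M(b) /\
    forall S : {set 'I_n}, S \subset V -> wt S (m - U_(b))%MM = wt S m.
  move=> mJ mb; have ws (S : {set 'I_n}) : S \subset V -> wt S (m - U_(b))%MM = wt S m.
    move=> SV; apply: eq_bigr => i iS; rewrite mnmBE mnm1E.
    have -> : (b == i) = false; last by rewrite subn0.
    by apply: contraNF bV => /eqP ->; apply: (subsetP SV).
  split=> //; move: mJ; rewrite !mem_filter => /andP[/eqP u mp].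
  rewrite mcoeff_msupp mcoeff_deriv submK ?lep1mP ?mb // mnmBE mnm1E eqxx mb subnn mulr1n.
  rewrite -mcoeff_msupp mp andbT sum_nat_eq0; apply/forallP => i; apply/implyP.
  move/eqP: u; rewrite sum_nat_eq0 => /forallP /(_ i).
  rewrite !inE negb_and negbK mnmBE mnm1E.
  have [->|ib] := eqVneq i b; first by rewrite mb.
  by rewrite subn0 /= => /implyP.
have ne : supp_in V p^`M(b) != [::].
  have [m [mJ mb _]] := step set0 (sub0set _); have [h _] := lift m mJ mb.
  by apply: contraTneq h => ->.
have H := IH V cV _ st' ne.
have : indic V \in msupp p^`M(b).
  apply: H => S SV; have [m [mJ mb hm]] := step S SV; have [h1 h2] := lift m mJ mb.
  by rewrite (leq_trans hm) // -(h2 _ SV) wt_rk.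
rewrite !mcoeff_msupp mcoeff_deriv mnmE (negPf bV) mulr1n.
suff -> : (indic V + U_(b))%MM = indic U by [].
apply/mnmP => i; rewrite mnmDE mnm1E !mnmE !inE.
by have [->|_] := eqVneq i b; rewrite /= ?bU ?addn0.
Qed.

Variable q : {mpoly R[n]}.
Hypothesis hq : S_hyperbolic q.

(** Hyperbolicity enters what follows only through these facts about the support, carried over from
    the [P_hyperbolic] polynomial to [q]. *)
Lemma S_hyperbolic_support : [/\ exchangeable (msupp q), msupp q != [::],
  {in msupp q, forall m, mdeg m = n} &
  (forall S : {set 'I_n}, (#|S| <= rk (msupp q) S)%N) -> ones n \in msupp q].
Proof.
case: hq => /dhomogP homq _ [p hyp spq]; have stp := P_hyperbolic_stable hyp.
have sub m : (m \in supp_in setT p) = (m \in msupp q).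
  by rewrite mem_filter spq /wt setCT big_set0.
have rkE S : rk (supp_in setT p) S = rk (msupp q) S.
  by apply/eqP; rewrite eqn_leq; apply/andP; split; apply/bigmax_leqP_seq => m mJ _;
    apply: wt_rk; rewrite ?sub // -sub.
have q0 : msupp q != [::].
  case: hyp => _ _ p1 _; have : p != 0 by apply: contraTneq p1 => ->; rewrite meval0 ltxx.
  rewrite -msupp_eq0; case E: (msupp p) => [|m s] // _.
  by have := spq m; rewrite E inE eqxx; case: (msupp q).
split=> //.
  move=> S D m1 m2 SD; rewrite -!sub => h1 h2 lt.
  by have [m []] := stable_exchangeable stp SD h1 h2 lt; rewrite sub => *; exists m.
move=> h; have -> : ones n = indic setT by apply/mnmP => i; rewrite !mnmE inE.
rewrite -spq; apply: indic_supp; first by rewrite cardsT card_ord.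
  by apply: contraNneq q0 => E; case: (msupp q) sub => // m s /(_ m); rewrite E inE eqxx.
by move=> S _; rewrite rkE.
Qed.

(** For the converse, a convex combination equal to (1, ..., 1) makes [#|S|] an average of the
    weights [wt S m], hence at most the rank of [S]. *)
Lemma problem1_iff_problem2 : problem1 q <-> problem2 q.
Proof.
have [_ _ hd H] := S_hyperbolic_support; split.
  move=> h; exists (fun m => (m == ones n)%:R); split=> [m _||i].
  - by rewrite ler0n.
  - by rewrite (bigD1_seq (ones n)) ?msupp_uniq //= eqxx big1 ?addr0 // => m /negPf ->.
  rewrite (bigD1_seq (ones n)) ?msupp_uniq //= eqxx big1 ?addr0.
    by rewrite mnmE mul1r.
  by move=> m /negPf ->; rewrite mul0r.
move=> [w [w0 w1 wx]]; apply: H => S.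
rewrite -(ler_nat R).
have -> : #|S|%:R = \sum_(m <- msupp q) w m * (wt S m)%:R.
  rewrite -sumr_const (eq_bigr _ (fun i _ => esym (wx i))) exchange_big /=.
  by apply: eq_bigr => m _; rewrite -mulr_sumr natr_sum.
rewrite -[leRHS]mul1r -[X in _ <= X * _]w1 mulr_suml big_seq [leRHS]big_seq.
by apply: ler_sum => m mq; apply: ler_wpM2l; [exact: w0|rewrite ler_nat wt_rk].
Qed.

End Ones.

(** * The perceptron on the base polytope *)

Section Perceptron.
Variables (n : nat) (J : seq 'X_{1..n}).
Hypotheses (exJ : exchangeable J) (J0 : J != [::]).
Hypothesis degJ : {in J, forall m, mdeg m = n}.
Hypothesis fullJ : (forall S : {set 'I_n}, (#|S| <= rk J S)%N) -> ones n \in J.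
Implicit Types (S X : {set 'I_n}) (w : 'I_n -> int) (u : 'I_n -> nat).

Lemma rk_set0 : rk J set0 = 0%N.
Proof. by apply/eqP; rewrite -leqn0; apply/bigmax_leqP_seq => m _ _; rewrite /wt big_set0. Qed.

Lemma rk_setT : rk J setT = n.
Proof. by have [m mJ <-] := rk_attained setT J0; rewrite wtT degJ. Qed.

Lemma rk_mono S X : S \subset X -> (rk J S <= rk J X)%N.
Proof.
move=> SX; have [m mJ <-] := rk_attained S J0.
by apply: leq_trans (wt_rk X mJ); rewrite (wt_sub m SX) leq_addr.
Qed.

Lemma rk_le_n S : (rk J S <= n)%N.
Proof. by rewrite -[leqRHS]rk_setT rk_mono ?subsetT. Qed.

(* [u] is the greedy base of the rank function restricted to [X]; the last
   clause, an Abel summation, makes it a minimizer of [w] once [X] is full. *)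
Definition greedy w X u : Prop :=
  [/\ forall i, i \notin X -> u i = 0%N,
      (\sum_(i in X) u i)%N = rk J X,
      forall i k, i \in X -> k \notin X -> w i <= w k,
      forall S, (\sum_(i in S) u i <= rk J S)%N
    & forall m (th : int), m \in J -> (forall i, i \in X -> w i <= th) ->
      \sum_(i in X) w i * (u i)%:Z <=
      \sum_(i in X) w i * (m i)%:Z + th * ((rk J X)%:Z - (wt X m)%:Z)].

Lemma greedy0 w : greedy w set0 (fun=> 0%N).
Proof.
split=> //.
- by rewrite big_set0 rk_set0.
- by move=> i k; rewrite inE.
- by move=> S; rewrite big1.
by move=> m th _ _; rewrite !big_set0 rk_set0 /wt big_set0 subrr mulr0.
Qed.

Lemma greedyS w X u b : greedy w X u -> b \notin X ->
  (forall k, k \notin X -> w b <= w k) ->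
  greedy w (b |: X) (fun i => if i == b then (rk J (b |: X) - rk J X)%N else u i).
Proof.
move=> [u0 uX wX uS um] bX wb.
have rkb : (rk J X <= rk J (b |: X))%N by rewrite rk_mono // subsetUr.
set v := fun i => _.
have vX S : b \notin S -> (\sum_(i in S) v i = \sum_(i in S) u i)%N.
  move=> bS; apply: eq_bigr => i iS; rewrite /v; case: eqP => // ib.
  by rewrite -ib iS in bS.
have vb : v b = (rk J (b |: X) - rk J X)%N by rewrite /v eqxx.
split.
- move=> i; rewrite !inE negb_or => /andP[/negPf ib iX].
  by rewrite /v ib u0.
- by rewrite big_setU1 //= vX // vb uX; lia.
- move=> i k; rewrite !inE negb_or => /orP[/eqP -> /andP[_ kX]|iX /andP[_ kX]].
    exact: wb.
  exact: wX.
- move=> S; have [bS|bS] := boolP (b \in S); last by rewrite vX.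
  rewrite (big_setD1 b) //= vb vX ?setD11 //.
  have sX : (\sum_(i in S :\ b) u i = \sum_(i in (S :\ b) :&: X) u i)%N.
    rewrite [LHS](big_setID X) /= addnC big1 ?add0n //.
    by move=> i; rewrite inE => /andP[iX _]; rewrite u0.
  (* Diminishing returns: the value given to [b] is at most the increment of [b] over the smaller
     set [(S :\ b) :&: X]. *)
  have := rk_submod exJ J0 (b |: ((S :\ b) :&: X)) X.
  have -> : (b |: ((S :\ b) :&: X)) :|: X = b |: X.
    by apply/setP => i; rewrite !inE; case: (i == b); case: (i \in X); case: (i \in S).
  have -> : (b |: ((S :\ b) :&: X)) :&: X = (S :\ b) :&: X.
    apply/setP => i; rewrite !inE; case: eqP => [->|_] //=; first by rewrite (negPf bX).
    by case: (i \in X); rewrite ?andbF ?andbT.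
  have := uS ((S :\ b) :&: X); rewrite -sX.
  have : (rk J (b |: ((S :\ b) :&: X)) <= rk J S)%N.
    by apply: rk_mono; rewrite subUset sub1set bS subIset // subD1set.
  by lia.
move=> m th mJ wth; have := um m (w b) mJ (fun i iX => wX i b iX bX).
rewrite !big_setU1 //= vb -subzn //.
have -> : \sum_(i in X) w i * (v i)%:Z = \sum_(i in X) w i * (u i)%:Z.
  apply: eq_bigr => i iX; rewrite /v; case: eqP => // ib.
  by rewrite -ib iX in bX.
have wtb : wt (b |: X) m = (m b + wt X m)%N by rewrite /wt big_setU1.
have := wt_rk (b |: X) mJ; rewrite wtb; have := wth b (setU11 _ _).
move: (\sum_(i in X) _) (\sum_(i in X) _) => s1 s2 h1 h2; rewrite -lez_nat in h2.
move: (w b) (rk J (b |: X)) (rk J X) (wt X m) (m b) h1 h2 => W r1 r2 x y h1 h2.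
by rewrite PoszD in h2 *; nia.
Qed.

Lemma greedy_optimal w u m : greedy w setT u -> m \in J ->
  \sum_i w i * (u i)%:Z <= \sum_i w i * (m i)%:Z.
Proof.
(* Any upper bound of [w] serves as threshold: its factor vanishes on the full set, where [m] has
   weight [n]. *)
move=> [_ _ _ _ um] mJ; have := um m (\sum_i `|w i|) mJ.
rewrite rk_setT wtT (degJ mJ) subrr mulr0 addr0.
have sT (F : 'I_n -> int) : \sum_(i in setT) F i = \sum_i F i.
  by apply: eq_bigl => i; rewrite inE.
rewrite !sT; apply=> i _; apply: le_trans (ler_norm _) _.
by rewrite (bigD1 i) //= lerDl sumr_ge0.
Qed.

(** The value of [w] at the greedy base is a lower bound of [w] on [J], so a positive pairing
    separates (1, ..., 1) from [J]. *)
Lemma greedy_certificate w u : greedy w setT u ->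
  0 < \sum_i w i * ((u i)%:Z - 1) -> ones n \notin J.
Proof.
move=> g pos; apply/negP => /(greedy_optimal g).
rewrite leNgt => /negP[]; rewrite -subr_gt0 -sumrB.
rewrite [X in _ < X](eq_bigr (fun i => w i * ((u i)%:Z - 1))) // => i _.
by rewrite mnmE mulrBr.
Qed.

(** The two perceptron bounds after [k] rounds: an update has squared norm at most [n ^ 2] and
    nonpositive pairing with [w], while on a set violating the rank condition it sums to at most
    -1. *)
Definition separating_walk (k : nat) w : Prop :=
  \sum_i w i ^+ 2 <= (k * n ^ 2)%N%:Z /\
  forall S, (rk J S < #|S|)%N -> \sum_(i in S) w i <= - k%:Z.

Lemma separating_walk0 : separating_walk 0 (fun=> 0).
Proof. by split=> [|S _]; rewrite big1 // oppr0. Qed.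

Lemma sum_Posz (I : finType) (P : pred I) (F : I -> nat) :
  (\sum_(i | P i) F i)%N%:Z = \sum_(i | P i) (F i)%:Z.
Proof. exact: (big_morph Posz PoszD (erefl _)). Qed.

Lemma separating_walkS k w u : separating_walk k w -> greedy w setT u ->
  \sum_i w i * ((u i)%:Z - 1) <= 0 ->
  separating_walk k.+1 (fun i => w i + (u i)%:Z - 1).
Proof.
move=> [w2 wS] [_ uT _ uS _] ip; split; last first.
  move=> S lt; have := wS S lt; have := uS S.
  have -> : \sum_(i in S) (w i + (u i)%:Z - 1) =
      \sum_(i in S) w i + (\sum_(i in S) u i)%N%:Z - #|S|%:Z.
    by rewrite sumrB big_split /= sumr_const natz sum_Posz.
  by move: (\sum_(i in S) w i) (\sum_(i in S) u i)%N => a c; lia.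
have -> : \sum_i (w i + (u i)%:Z - 1) ^+ 2 = \sum_i w i ^+ 2 +
    2 * (\sum_i w i * ((u i)%:Z - 1)) + \sum_i ((u i)%:Z - 1) ^+ 2.
  by rewrite mulr_sumr -!big_split /=; apply: eq_bigr => i _; ring.
have su : (\sum_i u i)%N = n.
  by rewrite -[RHS]rk_setT -uT; apply: eq_bigl => i; rewrite inE.
(* As [u i <= n] and the [u i] sum to [n], the left side is at most [n * n - 2 * n + n]. *)
have : \sum_i ((u i)%:Z - 1) ^+ 2 <= (n ^ 2)%N%:Z.
  apply: (@le_trans _ _ (\sum_(i < n) ((n * u i)%N%:Z - (2 * u i)%N%:Z + 1))).
    apply: ler_sum => i _; have : (u i <= n)%N by rewrite -su (bigD1 i) //= leq_addr.
    by rewrite !PoszM; move: (u i) => c; nia.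
  rewrite big_split sumrB /= sumr_const card_ord natz -!sum_Posz -!big_distrr /= su.
  by rewrite expnS expn1; clear; lia.
rewrite mulSn PoszD; move: w2 ip.
move: (\sum_i w i ^+ 2) (\sum_i _) (\sum_i _) (k * n ^ 2)%N (n ^ 2)%N => a b c d e.
by clear; lia.
Qed.

(* The bounds on the sum of [w] over [S] and on its norm conflict after [n ^ 3]
   rounds. *)
Lemma separating_walk_end k w : (n ^ 3 < k)%N -> separating_walk k w -> ones n \in J.
Proof.
move=> kn [w2 wS]; apply: fullJ => S; rewrite leqNgt; apply/negP => lt.
have {}wS := wS S lt.
have cS : (#|S| <= n)%N by rewrite -[leqRHS](card_ord n) max_card.
have n0 : (0 < n)%N by lia.
(* This square replaces Cauchy-Schwarz within the integers. The shift is minus the mean of [w] over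
   [S] in the critical case of sum [- n ^ 3] and [#|S| = n]. *)
have : 0 <= \sum_(i in S) (w i + (n ^ 2)%N%:Z) ^+ 2 by apply: sumr_ge0 => i _; rewrite sqr_ge0.
have -> : \sum_(i in S) (w i + (n ^ 2)%N%:Z) ^+ 2 = \sum_(i in S) w i ^+ 2 +
   2 * (n ^ 2)%N%:Z * (\sum_(i in S) w i) + #|S|%:Z * (n ^ 2)%N%:Z ^+ 2.
  rewrite (eq_bigr (fun i => w i ^+ 2 + 2 * (n ^ 2)%N%:Z * w i + (n ^ 2)%N%:Z ^+ 2)).
    by rewrite !big_split /= sumr_const -mulr_sumr -[X in _ + X = _]mulr_natl (natz #|S|).
  by move=> i _; ring.
have : \sum_(i in S) w i ^+ 2 <= \sum_i w i ^+ 2.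
  rewrite [leRHS](bigID (mem S)) /= lerDl sumr_ge0 // => i _; exact: sqr_ge0.
move: w2 wS; set a := \sum_(i in S) w i; set b := \sum_(i in S) _; set c := \sum_i _.
move=> h1 h2 h3.
have n2 : (0 < n ^ 2)%N by rewrite expn_gt0 n0.
have e3 : (n ^ 3 = n * n ^ 2)%N by rewrite expnS.
rewrite e3 in kn; move: (n ^ 2)%N n2 kn h1 h2 => N n2 kn h1 h2.
by nia.
Qed.

End Perceptron.

(** * The program *)

Section WeakestPrecondition.
Variables (n : nat) (f : {ffun 'I_n -> rat} -> rat) (V : {ffun 'I_n -> rat} -> Prop).
Implicit Types (c : com) (s : state) (Q : state -> Prop).

(** Total correctness with budgets [N] for queries and [T] for steps; [exec_det] later extends the
    bounds from one run to every run. *)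
Definition wp c s Q (N T : nat) : Prop := exists s' vs t,
  [/\ exec f c s s' vs t, Q s', (size vs <= N)%N, (t <= T)%N & {in vs, forall v, V v}].

Lemma wp_seq c1 c2 s Q N1 N2 N T1 T2 T :
  wp c1 s (fun s1 => wp c2 s1 Q N2 T2) N1 T1 ->
  (N1 + N2 <= N)%N -> (T1 + T2 <= T)%N -> wp (Seq c1 c2) s Q N T.
Proof.
move=> [s1 [vs1 [t1 [e1 [s2 [vs2 [t2 [e2 Q2 n2 h2 v2]]]] n1 h1 v1]]]] hN hT.
exists s2, (vs1 ++ vs2), (t1 + t2)%N; split=> //.
- exact: ExecSeq e1 e2.
- by rewrite size_cat (leq_trans _ hN) // leq_add.
- by rewrite (leq_trans _ hT) // leq_add.
by move=> v; rewrite mem_cat => /orP[/v1|/v2].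
Qed.

Lemma wp_skip s Q N T : Q s -> (0 < T)%N -> wp Skip s Q N T.
Proof. by move=> h T0; exists s, [::], 1%N; split=> //; exact: ExecSkip. Qed.

Lemma wp_iset k e s Q N T : (icost e < T)%N ->
  Q (set_ireg s k (ieval s e)) -> wp (ISet k e) s Q N T.
Proof. by move=> hT h; do 3 eexists; split; [exact: ExecISet| | | |]. Qed.

Lemma wp_qset a e s Q N T : (icost a + qcost e < T)%N ->
  Q (set_cell s (ieval s a) (qeval s e)) -> wp (QSet a e) s Q N T.
Proof. by move=> hT h; do 3 eexists; split; [exact: ExecQSet| | | |]. Qed.

Lemma wp_query d a s Q N T : (0 < N)%N -> (icost d + icost a < T)%N ->
  let v := [ffun i : 'I_n => cell s (ieval s a + i)%N] in V v ->
  Q (set_cell s (ieval s d) (f v)) -> wp (Query d a) s Q N T.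
Proof.
move=> N0 hT v hv h; do 3 eexists; split; [exact: ExecQuery|exact: h|by []|by []|].
by move=> u; rewrite inE => /eqP ->.
Qed.

Lemma wp_if b c1 c2 s Q N T : (tcost b < T)%N ->
  wp (if teval s b then c1 else c2) s Q N (T - (tcost b).+1) -> wp (If b c1 c2) s Q N T.
Proof.
move=> hT [s' [vs [t [e h n1 t1 v]]]]; exists s', vs, (tcost b + t).+1; split=> //.
  exact: ExecIf.
by lia.
Qed.

Lemma wp_while (I : nat -> state -> Prop) m b c s Q N T N' T' :
  I 0%N s ->
  (forall j s, I j s -> teval s b -> (j < m)%N /\ wp c s (I j.+1) N T) ->
  (forall j s, I j s -> ~~ teval s b -> Q s) ->
  (m * N <= N')%N -> (m * (T + (tcost b).+1) + (tcost b).+1 <= T')%N ->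
  wp (While b c) s Q N' T'.
Proof.
move=> I0 step stop hN hT.
suff H k j s0 : (j + k = m)%N -> I j s0 ->
    wp (While b c) s0 Q (k * N) (k * (T + (tcost b).+1) + (tcost b).+1).
  have [s' [vs [t [e h n1 t1 v]]]] := H m 0%N s (add0n _) I0.
  by exists s', vs, t; split=> //; [exact: leq_trans hN|exact: leq_trans hT].
elim: k j s0 => [|k IH] j s0 jk Ij.
  have [tb|tb] := boolP (teval s0 b).
    by have [jm _] := step _ _ Ij tb; rewrite -jk addn0 ltnn in jm.
  by exists s0, [::], (tcost b).+1; split; [exact: ExecWhileStop|exact: stop Ij tb| | |].
have [tb|tb] := boolP (teval s0 b); last first.
  exists s0, [::], (tcost b).+1; split=> //; [exact: ExecWhileStop|exact: stop Ij tb|].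
  by rewrite leq_addl.
have [jm [s1 [vs1 [t1 [e1 I1 n1 h1 v1]]]]] := step _ _ Ij tb.
have [|s2 [vs2 [t2 [e2 Q2 n2 h2 v2]]]] := IH j.+1 s1 _ I1; first by lia.
exists s2, (vs1 ++ vs2), (tcost b + t1 + t2).+1; split=> //.
- exact: ExecWhileLoop e1 e2.
- by rewrite size_cat mulSn leq_add.
- by rewrite mulSn; move: (k * _)%N h2 => z h2; lia.
by move=> v; rewrite mem_cat => /orP[/v1|/v2].
Qed.

Lemma wp_conseq c s (Q Q' : state -> Prop) N T N' T' : wp c s Q N T ->
  (forall s', Q s' -> Q' s') -> (N <= N')%N -> (T <= T')%N -> wp c s Q' N' T'.
Proof.
move=> [s' [vs [t [e h n1 t1 v]]]] QQ hN hT; exists s', vs, t; split=> //.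
- exact: QQ.
- exact: leq_trans hN.
- exact: leq_trans hT.
Qed.

End WeakestPrecondition.

(* Index registers: 0 the dimension n, 1 rounds completed, 2 variables already
   selected in the round, 3 scan position, 4 selected variable, 5 its greedy
   value, 6 positive once the certificate is found.
   Cells: [0, n) query point, [n, 2n) weights, 2n scale, 2n+1 oracle answer,
   2n+2 the power of the scale reached, 2n+3 pairing of the weights with the
   greedy base minus the all-ones vector. *)
Definition for_below (k bound : nat) (c : com) : com :=
  Seq (ISet k (IConst 0))
      (While (TNot (TIle (IReg bound) (IReg k)))
             (Seq c (ISet k (IAdd (IReg k) (IConst 1))))).

Definition scale_addr := IAdd (IReg 0) (IReg 0).
Definition answer_addr := IAdd scale_addr (IConst 1).
Definition power_addr := IAdd scale_addr (IConst 2).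
Definition pairing_addr := IAdd scale_addr (IConst 3).
Definition weight_addr (k : nat) := IAdd (IReg 0) (IReg k).

Definition reset_point : com := for_below 3 0 (QSet (IReg 3) (QConst 1)).

(** A variable is unselected when its coordinate in the query point is at most 1. Register 4 starts
    at variable 0, which may already be selected, whence the inner test. *)
Definition scan_weights : com :=
  Seq (ISet 4 (IConst 0)) (for_below 3 0
    (If (TQle (QCell (IReg 3)) (QConst 1))
       (If (TQle (QCell (IReg 4)) (QConst 1))
          (If (TQle (QCell (weight_addr 3)) (QCell (weight_addr 4)))
             (ISet 4 (IReg 3)) Skip)
          (ISet 4 (IReg 3)))
       Skip)).

(** The power is kept from one query of a round to the next: ranks grow along the chain of selected
    sets, so register 5 counts only the increment, which is the greedy value. *)
Definition measure_growth : com :=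
  Seq (ISet 5 (IConst 0))
      (While (TQle (QMul (QCell power_addr) (QCell scale_addr)) (QCell answer_addr))
             (Seq (QSet power_addr (QMul (QCell power_addr) (QCell scale_addr)))
                  (ISet 5 (IAdd (IReg 5) (IConst 1))))).

Definition excess := QSub (QNat (IReg 5)) (QConst 1).

(** Weights can be updated in place during a round, since [scan_weights] compares only unselected
    variables, whose weights are still the old ones. The pairing is updated first because it needs
    the old weight. *)
Definition select_next : com :=
  Seq scan_weights
  (Seq (QSet (IReg 4) (QCell scale_addr))
  (Seq (Query answer_addr (IConst 0))
  (Seq measure_growth
  (Seq (QSet pairing_addr
          (QAdd (QCell pairing_addr) (QMul (QCell (weight_addr 4)) excess)))
       (QSet (weight_addr 4) (QAdd (QCell (weight_addr 4)) excess)))))).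

Definition cube_dim := IMul (IReg 0) (IMul (IReg 0) (IReg 0)).

Definition round : com :=
  Seq reset_point
  (Seq (QSet power_addr (QConst 1))
  (Seq (QSet pairing_addr (QConst 0))
  (Seq (for_below 2 0 select_next)
  (Seq (If (TQle (QCell pairing_addr) (QConst 0)) Skip
           (ISet 6 (IAdd cube_dim (IConst 1))))
       (ISet 1 (IAdd (IReg 1) (IConst 1))))))).

(** Register 6 is 0 or [n ^ 3 + 1]. The latter stops the loop at once, and truncated subtraction
    turns the two values into the answers 1 and 0. *)
Definition perceptron : com :=
  Seq reset_point
  (Seq (Query scale_addr (IConst 0))
  (Seq (QSet scale_addr (QAdd (QCell scale_addr) (QConst 1)))
  (Seq (While (TIle (IAdd (IReg 1) (IReg 6)) cube_dim) round)
       (ISet 0 (ISub (IConst 1) (IReg 6)))))).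

(** * Verification of the program against a support and a growth estimate *)

Section Correctness.
Variables (n : nat) (J : seq 'X_{1..n}).
Hypotheses (exJ : exchangeable J) (J0 : J != [::]).
Hypothesis degJ : {in J, forall m, mdeg m = n}.
Hypothesis fullJ : (forall S : {set 'I_n}, (#|S| <= rk J S)%N) -> ones n \in J.
Variables (f : {ffun 'I_n -> rat} -> rat) (t : rat).
Hypothesis t1 : 1 < t.

Definition point (X : {set 'I_n}) : {ffun 'I_n -> rat} :=
  [ffun i => if i \in X then t else 1].

Hypothesis f1 : f (point set0) + 1 = t.
Hypothesis f_growth : forall X, t ^+ rk J X <= f (point X) < t ^+ (rk J X).+1.

Definition is_point (v : {ffun 'I_n -> rat}) : Prop := exists X, v = point X.

Local Notation wp := (wp f is_point).

Definition frame (rs : seq nat) (cs : pred nat) (s0 s : state) : Prop :=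
  (forall r, r \notin rs -> ireg s r = ireg s0 r) /\
  (forall a, ~~ cs a -> cell s a = cell s0 a).

Lemma wp_for_below (I : nat -> state -> Prop) k bnd c s Q m N T N' T' :
  k != bnd ->
  ireg s bnd = m ->
  (forall s', cell s' = cell s -> (forall r, r != k -> ireg s' r = ireg s r) -> I 0%N s') ->
  (forall j s', I j s' -> ireg s' k = j -> ireg s' bnd = m -> (j < m)%N ->
    wp c s' (fun s'' => [/\ ireg s'' k = j, ireg s'' bnd = m &
      forall s3, cell s3 = cell s'' -> (forall r, r != k -> ireg s3 r = ireg s'' r) ->
        I j.+1 s3]) N T) ->
  (forall s', I m s' -> Q s') ->
  (m * N <= N')%N -> (m * (T + 10) + 7 <= T')%N ->
  wp (for_below k bnd c) s Q N' T'.
Proof.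
move=> kb sm I0 step stop hN hT.
apply: (@wp_seq _ _ _ _ _ _ _ 0 N' _ 2 (m * (T + 10) + 5)) => //; last by rewrite add2n; lia.
apply: wp_iset => //=.
apply: (wp_while (I := fun j s => [/\ I j s, ireg s k = j, ireg s bnd = m & (j <= m)%N])
   (m := m) (N := N) (T := (T + 5)%N)) => //=.
- split=> //.
  - by apply: I0 => //= r /negPf ->.
  - by rewrite eqxx.
  - by rewrite eq_sym (negPf kb).
- move=> j s' [Ij sk sb jm]; rewrite sk sb -ltnNge => lt; split=> //.
  apply: (@wp_seq _ _ _ _ _ _ _ N 0 _ T 4); rewrite ?addn0 //; last by lia.
  apply: wp_conseq (step j s' Ij sk sb lt) _ _ _ => // s'' [ek eb H].
  apply: wp_iset => //=; split=> //.
  - by apply: H => //= r /negPf ->.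
  - by rewrite eqxx ek addn1.
  - by rewrite eq_sym (negPf kb).
- by move=> j s' [Ij sk sb jm]; rewrite sk sb -ltnNge -leqNgt => mj; apply: stop;
    have <- : j = m by lia.
- by lia.
Qed.

Lemma reset_point_wp s Q N : ireg s 0 = n ->
  (forall s', frame [:: 3%N] (fun a => (a < n)%N) s s' ->
     (forall a, (a < n)%N -> cell s' a = 1) -> Q s') ->
  wp reset_point s Q N (13 * n.+1).
Proof.
move=> sn HQ.
apply: (wp_for_below (I := fun j s' => frame [:: 3%N] (fun a => (a < n)%N) s s' /\
   forall a, (a < j)%N -> cell s' a = 1) (m := n) (N := 0) (T := 3)) => //=.
- by move=> s' ec er; split=> //; split=> [r|a _]; [rewrite inE; exact: er|rewrite ec].
- move=> j s' [[fr fc] h] s3 s0 jn.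
  apply: wp_qset => //=; split=> // s4 ec er; split.
    split=> [r|a an]; first by rewrite inE => r3; rewrite er //= fr // inE.
    by rewrite ec /= s3; case: eqP => [e|_]; [rewrite e jn in an|exact: fc].
  move=> a; rewrite ltnS leq_eqVlt ec /= s3; case: eqP => //= _; exact: h.
- by move=> s' [h1 h2]; apply: HQ.
- by rewrite muln0.
- by lia.
Qed.

Definition laid_out (X : {set 'I_n}) (w : 'I_n -> int) (s : state) : Prop :=
  [/\ ireg s 0 = n, cell s (n + n)%N = t,
      forall i : 'I_n, cell s i = if i \in X then t else 1
    & forall i : 'I_n, cell s (n + i)%N = (w i)%:~R].

Lemma scan_weights_wp X w s Q N : laid_out X w s -> X != setT ->
  (forall s' (b : 'I_n), frame [:: 3%N; 4%N] pred0 s s' -> ireg s' 4 = b ->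
     b \notin X -> (forall k, k \notin X -> w b <= w k) -> Q s') ->
  wp scan_weights s Q N (40 * n.+1).
Proof.
move=> [sn st sX sw] XT HQ.
have [i0 i0X] : exists i, i \notin X.
  apply/existsP; apply: contraR XT; rewrite negb_exists => /forallP h.
  by apply/eqP/setP => i; rewrite inE; have := h i; rewrite negbK.
have n0 : (0 < n)%N by apply: leq_ltn_trans (ltn_ord i0).
apply: (@wp_seq _ _ _ _ _ _ _ 0 N _ 2 (38 * n.+1)) => //; last by lia.
apply: wp_iset => //=.
(* As long as no unselected variable has been scanned, [b] is unconstrained. *)
pose best j (s' : state) := exists b : 'I_n, ireg s' 4 = b /\
  forall k : 'I_n, (k < j)%N -> k \notin X -> b \notin X /\ w b <= w k.
apply: (wp_for_below (I := fun j s' => frame [:: 3%N; 4%N] pred0 s s' /\ best j s')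
   (m := n) (N := 0) (T := 28)) => //=.
- move=> s' ec er; split; last first.
    by exists (Ordinal n0); split=> //; rewrite er.
  split=> [r|a _]; last by rewrite ec.
  by rewrite !inE negb_or => /andP[r3 r4]; rewrite er //= (negPf r4).
- move=> j s' [[fr fc] [b [s4 hb]]] s3 s0 jn.
  have cell_eq a : cell s' a = cell s a by exact: fc.
  pose i := Ordinal jn.
  pose post s'' := [/\ ireg s'' 3 = j, ireg s'' 0 = n & forall s3 : state,
    cell s3 = cell s'' -> (forall r, r != 3 -> ireg s3 r = ireg s'' r) ->
    frame [:: 3%N; 4%N] pred0 s s3 /\ best j.+1 s3].
  have skip : (forall k : 'I_n, (k < j.+1)%N -> k \notin X -> b \notin X /\ w b <= w k) ->
      wp Skip s' post 0 8.
    move=> h; apply: wp_skip => //; split=> // s5 ec er; split; last by exists b; rewrite er.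
    split=> [r|a _]; last by rewrite ec; exact: cell_eq.
    by rewrite !inE negb_or => /andP[r3 r4]; rewrite er // fr // !inE negb_or r3.
  have take : (forall k : 'I_n, (k < j.+1)%N -> k \notin X -> i \notin X /\ w i <= w k) ->
      wp (ISet 4 (IReg 3)) s' post 0 8.
    move=> h; apply: wp_iset => //; split=> // s5 ec er; split.
      split=> [r|a _]; last by rewrite ec; exact: cell_eq.
      by rewrite !inE negb_or => /andP[r3 r4]; rewrite er //= (negPf r4) fr // !inE negb_or r3.
    by exists i; split=> //; rewrite er //= s3.
  have cX (k : 'I_n) : (cell s k <= 1) = (k \notin X).
    by rewrite sX; case: (k \in X); rewrite /= ?lexx // leNgt t1.
  apply: wp_if => //=; rewrite s3 cell_eq (cX i).
  have lastE (k : 'I_n) : (k < j.+1)%N -> k = i \/ (k < j)%N.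
    by rewrite ltnS leq_eqVlt => /orP[/eqP e|kj]; [left; exact: val_inj|right].
  have [iX|/negPn iX] := boolP (i \notin X); last first.
    apply: wp_conseq (skip _) _ _ _ => // k /lastE[->|kj]; [by rewrite iX|exact: hb].
  apply: wp_if => //=; rewrite s4 cell_eq (cX b).
  have [bX|/negPn bX] := boolP (b \notin X); last first.
    apply: wp_conseq (take _) _ _ _ => // k /lastE[->|kj] kX; first by [].
    by have [] := hb k kj kX; rewrite bX.
  apply: wp_if => //=; rewrite s3 s4 s0 !cell_eq (sw i) (sw b) ler_int.
  have [le|lt] := leP (w i) (w b).
    apply: wp_conseq (take _) _ _ _ => // k /lastE[->|kj] kX; first by [].
    by have [_ h] := hb k kj kX; split=> //; exact: le_trans h.
  apply: wp_conseq (skip _) _ _ _ => // k /lastE[->|kj] kX; first by rewrite bX ltW.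
  by have [_ h] := hb k kj kX.
- move=> s' [fr [b [s4 hb]]]; have [bX _] := hb i0 (ltn_ord _) i0X.
  by apply: (HQ s' b) => // k kX; have [] := hb k (ltn_ord _) kX.
- by rewrite muln0.
- by lia.
Qed.

Lemma measure_growth_wp s d X Q N : ireg s 0 = n -> cell s (n + n)%N = t ->
  cell s (n + n + 2)%N = t ^+ d -> cell s (n + n + 1)%N = f (point X) ->
  (d <= rk J X)%N ->
  (forall s', frame [:: 5%N] (pred1 (n + n + 2)%N) s s' ->
     ireg s' 5 = (rk J X - d)%N -> cell s' (n + n + 2)%N = t ^+ rk J X -> Q s') ->
  wp measure_growth s Q N (50 * n.+1).
Proof.
move=> sn st sp sa dr HQ; have /andP[lo hi] := f_growth X.
apply: (@wp_seq _ _ _ _ _ _ _ 0 N _ 2 (48 * n.+1)) => //; last by lia.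
apply: wp_iset => //=.
pose I j s' := [/\ frame [:: 5%N] (pred1 (n + n + 2)%N) s s', ireg s' 5 = j,
  cell s' (n + n + 2)%N = t ^+ (d + j) & (d + j <= rk J X)%N].
apply: (wp_while (I := I) (m := n) (N := 0) (T := 22)) => //=.
- split=> //; rewrite ?addn0 //.
  by split=> // r; rewrite inE /= => /negPf ->.
- move=> j s' [[fr fc] s5 s2 le]; rewrite fr // sn s2 !fc /=; [|lia|lia].
  rewrite st sa -exprSr => le2.
  have {}lt : (d + j < rk J X)%N.
    rewrite ltnNge; apply/negP => ge; have := le_lt_trans le2 hi.
    by rewrite ltr_eXn2l // ltnS ltnNge ge.
  have := rk_le_n J0 degJ X; split; first by lia.
  apply: (@wp_seq _ _ _ _ _ _ _ 0 0 _ 17 4) => //.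
  apply: wp_qset => //=; apply: wp_iset => //=.
  rewrite !(fr 0%N) // !sn s5 s2; split=> //.
  + split=> [r|a /negPf h]; first by rewrite inE => /negPf h; rewrite /= h fr // inE h.
    by move: h; rewrite /= => h; rewrite h fc //= h.
  + by rewrite /= addn1.
  + by rewrite /= eqxx fc /= ?st -?exprSr ?addnS //; lia.
  + by rewrite addnS.
- move=> j s' [[fr fc] s5 s2 le]; rewrite fr // sn s2 !fc /=; [|lia|lia].
  rewrite st sa -exprSr -ltNge => lt2.
  have := le_lt_trans lo lt2; rewrite ltr_eXn2l // ltnS => ge.
  have e : rk J X = (d + j)%N by lia.
  by apply: HQ; rewrite ?e ?addKn.
- by rewrite muln0.
- by lia.
Qed.

Definition in_round w X u s : Prop :=
  [/\ laid_out X (fun i => if i \in X then w i + (u i)%:Z - 1 else w i) s,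
      cell s (n + n + 2)%N = t ^+ rk J X,
      cell s (n + n + 3)%N = (\sum_(i in X) w i * ((u i)%:Z - 1))%:~R
    & greedy J w X u].

Lemma select_next_wp w X u s Q : in_round w X u s -> X != setT ->
  (forall s' b u', frame [:: 3%N; 4%N; 5%N] predT s s' -> b \notin X ->
     in_round w (b |: X) u' s' -> Q s') ->
  wp select_next s Q 1 (200 * n.+1).
Proof.
move=> [lay sp si gr] XT HQ; have [sn st sX sw] := lay.
apply: (@wp_seq _ _ _ _ _ _ _ 0 1 _ (40 * n.+1) (160 * n.+1)) => //; last by lia.
apply: scan_weights_wp lay XT _ => s1 b [fr1 fc1] s14 bX wb.
have {}fc1 a : cell s1 a = cell s a by exact: fc1.
have s10 : ireg s1 0 = n by rewrite fr1.
apply: (@wp_seq _ _ _ _ _ _ _ 0 1 _ 6 (150 * n.+1)) => //; last by lia.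
apply: wp_qset => //=; rewrite s10 s14 fc1 st.
set s2 := set_cell s1 b t.
apply: (@wp_seq _ _ _ _ _ _ _ 1 0 _ 7 (140 * n.+1)) => //; last by lia.
have b_n := ltn_ord b.
have vE : [ffun i : 'I_n => cell s2 (ieval s2 (IConst 0) + i)%N] = point (b |: X).
  apply/ffunP => i; rewrite !ffunE /= add0n !inE.
  have -> : (i == b :> nat) = (i == b) by [].
  by case: (i == b); rewrite // fc1 sX.
apply: wp_query => //; first by rewrite vE; exists (b |: X).
rewrite vE /= s10; set s3 := set_cell s2 _ _.
apply: (@wp_seq _ _ _ _ _ _ _ 0 0 _ (50 * n.+1) (90 * n.+1)) => //; last by lia.
have rkb : (rk J X <= rk J (b |: X))%N by rewrite rk_mono // subsetUr.
have c3 a : a != (n + n + 1)%N -> a != b -> cell s3 a = cell s a.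
  by move=> h1 h0; rewrite /= (negPf h1) (negPf h0) fc1.
apply: (@measure_growth_wp s3 (rk J X) (b |: X)) => //.
- by rewrite c3 //; lia.
- by rewrite c3 //; lia.
- by rewrite /= eqxx.
move=> s4 [fr4 fc4] s45 s4p.
have s40 : ireg s4 0 = n by rewrite fr4.
have s44 : ireg s4 4 = b by rewrite fr4.
pose u' := fun i => if i == b then (rk J (b |: X) - rk J X)%N else u i.
have c4 a : a != (n + n + 2)%N -> a != (n + n + 1)%N -> a != b -> cell s4 a = cell s a.
  by move=> h2 h1 h0; rewrite fc4 // c3.
have wb4 : cell s4 (n + b)%N = (w b)%:~R.
  by rewrite c4 ?sw ?(negPf bX) //; lia.
have c4b : cell s4 b = t.
  rewrite fc4 /=; last by lia.
  by rewrite (_ : (_ == n + n + 1)%N = false) ?eqxx //; lia.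
have ip4 : cell s4 (n + n + 3)%N = (\sum_(i in X) w i * ((u i)%:Z - 1))%:~R.
  by rewrite c4 ?si //; lia.
apply: (@wp_seq _ _ _ _ _ _ _ 0 0 _ 22 13) => //; last by lia.
apply: wp_qset => //=; rewrite s40 s44 s45 wb4 ip4.
apply: wp_qset => //=; rewrite s40 s44 s45 (_ : (n + b == _)%N = false) ?wb4; last by lia.
set s6 := set_cell _ _ _.
have c6 a : a != (n + b)%N -> a != (n + n + 3)%N -> cell s6 a = cell s4 a.
  by move=> h1 h2; rewrite /s6 /= (negPf h1) (negPf h2).
have uX i : i \in X -> u' i = u i.
  by move=> iX; rewrite /u'; case: eqP => // ib; rewrite -ib iX in bX.
have ub : u' b = (rk J (b |: X) - rk J X)%N by rewrite /u' eqxx.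
apply: (HQ _ b u') => //.
  split=> // r; rewrite !inE !negb_or => /and3P[r3 r4 r5].
  by rewrite [LHS]fr4 ?inE // [LHS]fr1 // !inE negb_or r3.
split.
- split=> //.
  + by rewrite c6 ?c4 //; lia.
  + move=> i; have i_n := ltn_ord i; rewrite c6; [|lia|lia].
    rewrite !inE; have [->|ib] := eqVneq i b; last first.
      have {}ib : (i != b)%N by [].
      by rewrite c4 ?sX //; lia.
    exact: c4b.
  + move=> i; have i_n := ltn_ord i; rewrite !inE.
    have [->|ib] := eqVneq i b.
      by rewrite /= eqxx ub -addrA !rmorphD /= rmorphN.
    have {}ib : i != b :> nat by [].
    rewrite c6 ?c4 ?sw /=; [|lia|lia|lia|lia|lia].
    by case: ifP => // iX; rewrite uX.
- by rewrite c6 ?s4p //; lia.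
- rewrite /s6 /= eqxx (_ : (_ == _) = false); last by lia.
  rewrite big_setU1 //= ub addrC rmorphD rmorphM rmorphB /=; congr (_ + _).
  by congr (_%:~R); apply: eq_bigr => i iX; rewrite uX.
apply: greedyS => // k kX.
by have := wb k kX; rewrite (negPf bX) (negPf kX).
Qed.

Definition between_rounds w s : Prop :=
  [/\ ireg s 0 = n, cell s (n + n)%N = t & forall i : 'I_n, cell s (n + i)%N = (w i)%:~R].

Lemma round_wp w s Q : between_rounds w s ->
  (forall s' u, greedy J w setT u ->
     between_rounds (fun i => w i + (u i)%:Z - 1) s' ->
     ireg s' 1 = (ireg s 1).+1 ->
     ireg s' 6 = (if \sum_i w i * ((u i)%:Z - 1) <= 0 then ireg s 6 else (n ^ 3).+1) -> Q s') ->
  wp round s Q n (400 * n.+1 ^ 2).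
Proof.
move=> [sn st sw] HQ.
have sq : (n.+1 ^ 2 = n * n.+1 + n.+1)%N by rewrite expnS expn1; lia.
apply: (@wp_seq _ _ _ _ _ _ _ 0 n _ (13 * n.+1) (385 * n.+1 ^ 2)) => //; last first.
  by rewrite sq; lia.
apply: reset_point_wp => // s1 [fr1 fc1] v1.
have s10 : ireg s1 0 = n by rewrite fr1.
apply: (@wp_seq _ _ _ _ _ _ _ 0 n _ 7 (370 * n.+1 ^ 2)) => //; last by rewrite sq; lia.
apply: wp_qset => //=; rewrite s10.
apply: (@wp_seq _ _ _ _ _ _ _ 0 n _ 7 (360 * n.+1 ^ 2)) => //; last by rewrite sq; lia.
apply: wp_qset => //=; rewrite s10.
set s3 := set_cell _ _ _.
have c3 a : a != (n + n + 2)%N -> a != (n + n + 3)%N -> cell s3 a = cell s1 a.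
  by move=> h2 h3; rewrite /s3 /= (negPf h3) (negPf h2).
have start : in_round w set0 (fun=> 0%N) s3.
  split.
  - split=> //.
    + by rewrite c3 ?fc1 //; lia.
    + by move=> i; have i_n := ltn_ord i; rewrite c3 ?v1 ?inE //; lia.
    + by move=> i; have i_n := ltn_ord i; rewrite c3 ?fc1 ?inE //; lia.
  - by rewrite /s3 /= (_ : (_ == _) = false) ?eqxx ?(rk_set0 J) //; lia.
  - by rewrite /s3 /= eqxx big_set0.
  exact: greedy0.
apply: (@wp_seq _ _ _ _ _ _ _ n 0 _ (250 * n.+1 ^ 2) 50) => //; [|by lia|by rewrite sq; lia].
pose I j s' := exists X u, [/\ in_round w X u s', #|X| = j,
   ireg s' 1 = ireg s 1 & ireg s' 6 = ireg s 6].
apply: (wp_for_below (I := I) (m := n) (N := 1) (T := (200 * n.+1)%N)) => //.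
- move=> s' ec er; exists set0, (fun=> 0%N); rewrite cards0 !er //= !fr1 //; split=> //.
  by case: start => -[h1 h2 h3 h4] h5 h6 h7; split; rewrite ?ec //; split; rewrite ?er ?ec.
- move=> j s' [X [u [iX cX r1 r6]]] s'2 s'0 jn.
  have XT : X != setT by apply/eqP => XT; rewrite -cX XT cardsT card_ord ltnn in jn.
  apply: select_next_wp iX XT _ => s4 b u' [fr4 _] bX iX4.
  split; [by rewrite fr4|by rewrite fr4|].
  move=> s5 ec er; exists (b |: X), u'; rewrite cardsU1 bX cX !er // !fr4 //; split=> //.
  by case: iX4 => -[h1 h2 h3 h4] h5 h6 h7; split; rewrite ?ec //; split; rewrite ?er ?ec.
- move=> s4 [X [u [iX cX r1 r6]]].
  have XT : X = setT by apply/eqP; rewrite eqEcard subsetT cardsT card_ord cX leqnn.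
  rewrite {}XT in iX; case: iX => -[h1 h2 h3 h4] h5 h6 h7.
  have fin s5 : cell s5 = cell s4 -> ireg s5 0 = n -> ireg s5 1 = ireg s 1 ->
      ireg s5 6 = (if \sum_i w i * ((u i)%:Z - 1) <= 0 then ireg s 6 else (n ^ 3).+1) ->
      wp (ISet 1 (IAdd (IReg 1) (IConst 1))) s5 Q 0 6.
    move=> e5 e0 e1 e6; apply: wp_iset => //=; apply: (HQ _ u) => //=.
    + by split=> //= [|i]; rewrite e5 ?h4 ?inE.
    + by rewrite e1 addn1.
  apply: (@wp_seq _ _ _ _ _ _ _ 0 0 _ 40 6) => //.
  apply: wp_if => //=; rewrite h1 h6.
  have -> : \sum_(i in setT) w i * ((u i)%:Z - 1) = \sum_i w i * ((u i)%:Z - 1).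
    by apply: eq_bigl => i; rewrite inE.
  rewrite lerz0; case: ifPn => le.
    by apply: wp_skip => //; apply: fin; rewrite ?le.
  apply: wp_iset => //=; apply: fin; rewrite ?(negPf le) //=.
  by rewrite h1 addn1 !expnS expn0 muln1.
- by rewrite muln1.
- by rewrite sq; lia.
Qed.

(** The query budget is [n] calls in each of at most [n ^ 3 + 1] rounds, and one call for the
    scale. *)
Lemma perceptron_wp :
  wp perceptron (init_state n) (fun s => ireg s 0 = (ones n \in J) :> nat)
    ((n ^ 3).+1 * n).+1 (600 * n.+1 ^ 5).
Proof.
have e3 : (n * (n * n) = n ^ 3)%N by rewrite !expnS expn0 muln1.
have e5 : (n ^ 3 * n.+1 ^ 2 + n ^ 3 + n.+1 ^ 2 <= n.+1 ^ 5)%N.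
  by rewrite !expnS !expn0 !muln1; clear; lia.
have e2 : (n.+1 <= n.+1 ^ 2)%N by rewrite expnS leq_pmulr // expn_gt0.
pose a := (n ^ 3)%N; pose b := (n.+1 ^ 2)%N; pose c := (n ^ 3 * n.+1 ^ 2)%N.
have T0 : (13 * n.+1 + (400 * c + 400 * b + 20 * a + 100) <= 600 * n.+1 ^ 5)%N.
  have b1 : (1 <= b)%N by rewrite expn_gt0.
  by rewrite /a /b /c in b1 *; lia.
apply: (@wp_seq _ _ _ _ _ _ _ 0 ((n ^ 3).+1 * n).+1 _ (13 * n.+1)
  (400 * c + 400 * b + 20 * a + 100)) => //.
apply: reset_point_wp => // s1 [fr1 fc1] v1.
have r1 r : r != 3 -> ireg s1 r = (if r == 0%N then n else 0%N).
  by move=> h; rewrite fr1 ?inE //=; case: r h.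
have s10 : ireg s1 0 = n by rewrite r1.
apply: (@wp_seq _ _ _ _ _ _ _ 1 ((n ^ 3).+1 * n) _ 5
  (400 * c + 400 * b + 20 * a + 90)) => //; last by lia.
have vE : [ffun i : 'I_n => cell s1 (ieval s1 (IConst 0) + i)%N] = point set0.
  by apply/ffunP => i; rewrite !ffunE /= add0n inE v1.
apply: wp_query => //; first by rewrite vE; exists set0.
rewrite vE /= s10.
apply: (@wp_seq _ _ _ _ _ _ _ 0 ((n ^ 3).+1 * n) _ 10
  (400 * c + 400 * b + 20 * a + 70)) => //; last by lia.
apply: wp_qset => //=; rewrite s10 eqxx f1.
set s3 := set_cell _ _ _.
have start : between_rounds (fun=> 0) s3.
  split=> //; first by rewrite /= eqxx.
  move=> i; have i_n := ltn_ord i; rewrite /= (_ : (n + i == n + n)%N = false); last by lia.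
  by rewrite fc1 //; lia.
apply: (@wp_seq _ _ _ _ _ _ _ ((n ^ 3).+1 * n) 0 _
  (400 * c + 400 * b + 20 * a + 60) 4) => //; [|by rewrite addn0|by lia].
(* Either no certificate has been met and the perceptron bounds hold, or register 6 records that (1,
   ..., 1) is excluded. *)
pose I k s' := exists w, [/\ between_rounds w s', ireg s' 1 = k &
  (ireg s' 6 = 0%N /\ separating_walk J k w) \/ (ireg s' 6 = (n ^ 3).+1 /\ ones n \notin J)].
apply: (wp_while (I := I) (m := (n ^ 3).+1) (N := n) (T := (400 * n.+1 ^ 2)%N)) => //.
- exists (fun=> 0); split=> //; first by rewrite /= r1.
  by left; rewrite /= r1 //; split=> //; exact: separating_walk0.
- move=> k s' [w [bw s'1 alt]]; have [s'0 _ _] := bw.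
  rewrite /= s'0 s'1 e3 => le.
  case: alt => [[s'6 walk]|[s'6 _]]; last by move: le; rewrite s'6 leqNgt ltnS leq_addl.
  split; first by rewrite ltnS (leq_trans _ le) ?leq_addr.
  apply: round_wp bw _ => s4 u gr bw4 s41 s46.
  exists (fun i => w i + (u i)%:Z - 1); split=> //; first by rewrite s41 s'1.
  move: s46; case: ifPn => [ip s46|]; [left|rewrite -ltNge => ip s46; right].
    by rewrite s46 s'6; split=> //; exact: separating_walkS ip.
  by split=> //; exact: greedy_certificate ip.
- move=> k s' [w [bw s'1 alt]]; have [s'0 _ _] := bw.
  rewrite /= s'0 s'1 e3 -ltnNge => lt; apply: wp_iset => //=.
  case: alt => [[s'6 walk]|[-> /negPf -> //]]; rewrite s'6 addn0 in lt *.
  by rewrite (separating_walk_end J0 fullJ lt walk).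
- have -> : tcost (TIle (IAdd (IReg 1) (IReg 6)) cube_dim) = 9%N by [].
  by rewrite mulSn; move: e2; rewrite /a /b /c; clear; lia.
Qed.

End Correctness.

(** * The oracle of an S-hyperbolic polynomial *)

Section Run.
Variables (R : realType) (n : nat) (q : {mpoly int[n]}).
Hypothesis hq : S_hyperbolic_int R q.
Local Notation qR := (map_mpoly (intr : int -> R) q).
Local Notation Q := (q.@[fun=> 1]).

Let suppE m : (m \in msupp qR) = (m \in msupp q).
Proof. by rewrite !mcoeff_msupp mcoeff_map_mpoly intr_eq0. Qed.

Let coef_ge0 m : 0 <= q@_m.
Proof. by case: hq => _ /(_ m); rewrite mcoeff_map_mpoly ler0z. Qed.

Let coef_ge1 m : m \in msupp q -> 1 <= q@_m.
Proof. by rewrite mcoeff_msupp => h; rewrite -gtz0_ge1 lt0r h coef_ge0. Qed.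

Let QE : Q = \sum_(m <- msupp q) q@_m.
Proof.
rewrite mevalE; apply: eq_bigr => m _; rewrite big1 ?mulr1 // => i _.
by rewrite expr1n.
Qed.

Lemma at_ones_ge1 : 1 <= Q.
Proof.
have [_ J0 _ _] := S_hyperbolic_support hq.
have [m mJ _] := rk_attained set0 J0; rewrite suppE in mJ.
rewrite QE (bigD1_seq m) ?msupp_uniq //= (le_trans (coef_ge1 mJ)) // lerDl.
by apply: sumr_ge0.
Qed.

Definition scale : rat := Q%:~R + 1.

Let scale_gt1 : 1 < scale.
Proof. by rewrite ltrDr ltr0z (lt_le_trans _ at_ones_ge1). Qed.

Let oracleE X : oracle q (point scale X) = \sum_(m <- msupp q) (q@_m)%:~R * scale ^+ wt X m.
Proof.
rewrite /oracle mevalE; under eq_bigr do rewrite mcoeff_map_mpoly.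
rewrite (perm_big (msupp q)) /=; last first.
  apply: uniq_perm; rewrite ?msupp_uniq // => m.
  by rewrite !mcoeff_msupp mcoeff_map_mpoly intr_eq0.
apply: eq_bigr => m _; congr (_ * _); rewrite /wt -prodrXr [RHS]big_mkcond.
by apply: eq_bigr => i _; rewrite ffunE; case: ifP; rewrite // expr1n.
Qed.

Let oracle_ones : oracle q (point scale set0) + 1 = scale.
Proof.
rewrite oracleE /scale QE rmorph_sum; congr (_ + 1); apply: eq_bigr => m _.
by rewrite /wt big_set0 expr0 mulr1.
Qed.

(** Below, integrality makes each coefficient in the support at least 1; above, the coefficients sum
    to less than the scale. *)
Let oracle_growth X :
  scale ^+ rk (msupp qR) X <= oracle q (point scale X) < scale ^+ (rk (msupp qR) X).+1.
Proof.
have s0 : 0 < scale := lt_trans ltr01 scale_gt1.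
have [_ J0 _ _] := S_hyperbolic_support hq.
have [m mJ mX] := rk_attained X J0; rewrite oracleE; apply/andP; split.
  rewrite suppE in mJ; rewrite -mX (bigD1_seq m) ?msupp_uniq //=.
  apply: le_trans (_ : (q@_m)%:~R * scale ^+ wt X m <= _).
    by rewrite ler_peMl ?ler1z ?coef_ge1 // exprn_ge0 // ltW.
  rewrite lerDl sumr_ge0 // => m' _.
  by rewrite mulr_ge0 ?ler0z ?coef_ge0 // exprn_ge0 // ltW.
apply: (@le_lt_trans _ _ (Q%:~R * scale ^+ rk (msupp qR) X)).
  rewrite QE rmorph_sum mulr_suml big_seq [leRHS]big_seq; apply: ler_sum => m' m'q /=.
  rewrite ler_wpM2l ?ler0z ?coef_ge0 // ler_weXn2l ?ltW //.
  by rewrite wt_rk ?suppE.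
by rewrite exprS ltr_pM2r ?exprn_gt0 // ltrDl ltr01.
Qed.

Lemma perceptron_run : exists s vs t,
  [/\ exec (oracle q) perceptron (init_state n) s vs t,
      ireg s 0 = (ones n \in msupp q) :> nat,
      (size vs <= ((n ^ 3).+1 * n).+1)%N,
      (t <= 600 * n.+1 ^ 5)%N
    & {in vs, forall v, is_point scale v}].
Proof.
have [exJ J0 dJ fJ] := S_hyperbolic_support hq.
have [s [vs [t [e r0 nv tv hv]]]] :=
  perceptron_wp exJ J0 dJ fJ scale_gt1 oracle_ones oracle_growth.
by exists s, vs, t; rewrite r0 suppE.
Qed.

(** The coordinates are the integers 1 and q(1, ..., 1) + 1; the final 2 counts one digit for the
    denominator and the sign. *)
Lemma point_bit_size (v : {ffun 'I_n -> rat}) : is_point scale v ->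
  (vec_bit_size v <= up_log 2 (`|Q| + 2) + 2)%N.
Proof.
move=> [X ->]; apply/bigmax_leqP => i _; rewrite ffunE.
have b1 (k : nat) : bit_size (k%:R : rat) = (up_log 2 k.+1 + 2)%N.
  by rewrite /bit_size pmulrn numq_int denq_int /= -addnA.
have sE : scale = (`|Q| + 1)%N%:R.
  by rewrite /scale natrD -[X in X%:~R]gez0_abs // (le_trans ler01 at_ones_ge1).
case: ifP => _; first by rewrite sE b1 -addnS.
rewrite (b1 1%N) leq_add2r; apply: leq_up_log; lia.
Qed.
End Run.

(** * Query and time bounds *)

Section Logarithms.
Variable R : realType.
Local Notation ln := (@exp.ln R).

Lemma up_log2_ln (N : nat) : (0 < N)%N ->
  (up_log 2 (N + 2) + 2)%N%:R <= 3 + ln 3 / ln 2 + ln N%:R / ln 2.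
Proof.
move=> N0; have l2 : 0 < ln 2 by rewrite exp.ln_gt0 // ltr1n.
(* This power of 2 is below [N + 2], which is at most [3 * N]; the logarithm then splits off a
   constant. *)
have : ln ((2 ^ (up_log 2 (N + 2)).-1)%N%:R) <= ln (3 * N%:R).
  rewrite exp.ler_ln ?posrE ?ltr0n ?expn_gt0 ?mulr_gt0 ?ltr0n //.
  rewrite -natrM ler_nat.
  have N2 : (1 < N + 2)%N by lia.
  by have := up_log_gtn (isT : 1 < 2)%N N2; lia.
rewrite natrX exp.lnXn // exp.lnM ?posrE ?ltr0n // -[leLHS]mulr_natl => h.
have {}h : (up_log 2 (N + 2)).-1%:R <= ln 3 / ln 2 + ln N%:R / ln 2.
  by rewrite -mulrDl ler_pdivlMr.
have -> : (up_log 2 (N + 2) + 2 = (up_log 2 (N + 2)).-1 + 3)%N.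
  by have := up_log_gt0 2 (N + 2); lia.
by rewrite natrD; lra.
Qed.

(* [ln n + ln (ln N) = ln (ln (N ^ n))] is positive only if the integer [N ^ n]
   exceeds [e]. *)
Lemma ln_ln_gap : exists2 c : R, 0 < c & forall n N : nat, (0 < n)%N -> (1 < N)%N ->
  0 < ln n%:R + ln (ln N%:R) -> c <= ln n%:R + ln (ln N%:R).
Proof.
(* The least integer above e, so that [N ^ n], once above e, is at least [N0]. *)
pose N0 := (Num.trunc (sequences.expR 1 : R)).+1.
have eN0 : sequences.expR 1 < N0%:R :> R by rewrite truncnS_gt.
have lN0 : 1 < ln N0%:R.
  by move: eN0; rewrite -exp.ltr_ln ?posrE ?exp.expR_gt0 ?ltr0n // exp.expRK.
exists (ln (ln N0%:R)); first by rewrite exp.ln_gt0.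
move=> n N n0 N1; have lN : 0 < ln N%:R by rewrite exp.ln_gt0 // ltr1n.
have n0R : 0 < n%:R :> R by rewrite ltr0n.
rewrite -exp.lnM ?posrE //.
have -> : n%:R * ln N%:R = ln ((N ^ n)%N%:R).
  by rewrite natrX exp.lnXn ?mulr_natl // ltr0n ltnW.
have Nn0 : 0 < (N ^ n)%N%:R :> R by rewrite ltr0n expn_gt0 ltnW.
move=> pos; have l1 : 1 < ln (N ^ n)%N%:R.
  by rewrite ltNge; apply/negP => /exp.ln_le0; rewrite leNgt pos.
have e0 := exp.expR_gt0 (1 : R).
have eN : sequences.expR 1 < (N ^ n)%N%:R :> R.
  by rewrite -exp.ltr_ln ?posrE // exp.expRK.
have le : (N0 <= N ^ n)%N by rewrite /N0 truncn_lt_nat // ltW.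
have lele : ln N0%:R <= ln (N ^ n)%N%:R.
  by rewrite exp.ler_ln ?ler_nat // posrE ltr0n.
by rewrite exp.ler_ln ?posrE ?(lt_trans ltr01 lN0) ?(lt_trans ltr01 l1).
Qed.
End Logarithms.

Section Bounds.
Variable R : realType.
Local Notation ln := (@exp.ln R).

(** The query bounds are required of every run; determinism identifies it with the one
    constructed. *)
Let run_unique n (q : {mpoly int[n]}) : S_hyperbolic_int R q ->
  forall answer vs t, runs perceptron q answer vs t ->
  [/\ answer = (ones n \in msupp q), (size vs <= ((n ^ 3).+1 * n).+1)%N,
     (t <= 600 * n.+1 ^ 5)%N & {in vs, forall v, is_point (scale q) v}].
Proof.
move=> hq answer vs t [s e r0].
have [s' [vs' [t' [e' r' nv tv hv]]]] := perceptron_run hq.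
have [Es Ev Et] := exec_det e e'; subst s' vs' t'; split=> //.
by move: r0; rewrite r'; case: answer; case: (_ \in _).
Qed.

Let run_exists n (q : {mpoly int[n]}) : S_hyperbolic_int R q ->
  exists vs t, runs perceptron q (ones n \in msupp q) vs t.
Proof.
move=> /perceptron_run[s [vs [t [e r0 _ _ _]]]]; exists vs, t; by exists s.
Qed.

Let c1 : R := 3 + ln 3 / ln 2.
Let c2 : R := (ln 2)^-1.

Let ln2_gt0 : 0 < ln 2. Proof. by rewrite exp.ln_gt0 // ltr1n. Qed.
Let c1_ge0 : 0 <= c1.
Proof. by rewrite addr_ge0 // divr_ge0 ?exp.ln_ge0 ?ler1n. Qed.
Let c2_ge0 : 0 <= c2. Proof. by rewrite invr_ge0 ltW. Qed.

Let at_onesE n (q : {mpoly int[n]}) : S_hyperbolic_int R q ->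
  (0 < `|q.@[fun=> 1%R]|)%N /\ at_ones R q = `|q.@[fun=> 1%R]|%:R.
Proof.
move=> hq; have Q1 := at_ones_ge1 hq; split; first by lia.
by rewrite /at_ones -[X in X%:~R]gez0_abs // (le_trans ler01).
Qed.

Let bits_bound n (q : {mpoly int[n]}) (v : {ffun 'I_n -> rat}) :
  S_hyperbolic_int R q -> is_point (scale q) v ->
  (vec_bit_size v)%:R <= c1 + c2 * ln (at_ones R q).
Proof.
move=> hq /(point_bit_size hq); rewrite -(ler_nat R) => /le_trans; apply.
have [Q0 ->] := at_onesE hq.
by apply: le_trans (up_log2_ln R Q0) _; rewrite [c2 * _]mulrC.
Qed.

Lemma perceptron_solves : solves_problem1 R perceptron.
Proof.
move=> n q hq; have [vs [t r]] := run_exists hq.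
by exists (ones n \in msupp q), vs, t.
Qed.

Lemma perceptron_poly_time : poly_time R perceptron.
Proof.
(* The first summand is for the bit size of the queries, 600 for the numbers of queries and
   steps. *)
pose a := (Num.trunc (c1 + c2)).+1 + 600.
exists a, 5%N => n q hq B; have [vs [t r]] := run_exists hq.
exists (ones n \in msupp q), vs, t; have [_ nv tv hv] := run_unique hq r.
have [Q0 QE] := at_onesE hq.
have l0 : 0 <= ln (at_ones R q) by rewrite QE exp.ln_ge0 // ler1n.
have b1 : 1 <= 1 + n%:R + ln (at_ones R q).
  by rewrite -addrA lerDl addr_ge0.
have nb : 600%:R * n.+1%:R ^+ 5 <= B.
  rewrite /B ler_pM ?exprn_ge0 ?ler0n // ?ler_nat ?leq_addl //.
  rewrite lerXn2r ?nnegrE ?ler0n ?(le_trans ler01 b1) //.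
  by rewrite -natr1 addrC lerDl.
have tB : (600 * n.+1 ^ 5)%N%:R <= B by rewrite natrM natrX.
split=> //.
- apply: le_trans tB; rewrite ler_nat (leq_trans nv) // !expnS !expn0 !muln1; clear; lia.
- move=> v /hv/(bits_bound hq)/le_trans; apply.
  have ca : c1 + c2 <= a%:R.
    apply: ltW; apply: lt_le_trans (truncnS_gt _) _; by rewrite ler_nat leq_addr.
  apply: (@le_trans _ _ ((c1 + c2) * (1 + n%:R + ln (at_ones R q)))).
    rewrite -subr_ge0.
    rewrite [leRHS](_ : _ = c1 * (n%:R + ln (at_ones R q)) + c2 * (1 + n%:R)); last by ring.
    by rewrite addr_ge0 // mulr_ge0 // addr_ge0.
  apply: ler_pM => //; [exact: addr_ge0|exact: le_trans b1|].
  by apply: ler_eXnr.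
- by apply: le_trans tB; rewrite ler_nat.
Qed.

Lemma perceptron_query_count : query_count_bound R perceptron.
Proof.
have [c c0 gap] := ln_ln_gap R.
(* The factor 3 comes from [n ^ 4 + n + 1 <= 3 * n ^ 4], and [c] bounds the logarithmic factor from
   below. *)
exists (3 / c) => n q hq n0 Q1 pos answer vs t r.
have [_ nv _ _] := run_unique hq r; have [_ QE] := at_onesE hq.
rewrite QE ltr1n in Q1; rewrite QE in pos *; have {}gap := gap _ _ n0 Q1 pos.
apply: (@le_trans _ _ (3 * n%:R ^+ 4)).
  rewrite -natrX -natrM ler_nat (leq_trans nv) // !expnS !expn0 !muln1.
  have : (0 < n * (n * n))%N by rewrite !muln_gt0 n0.
  by move: (n * (n * n))%N n0 => m; clear; nia.
rewrite -mulrA ler_wpM2l // mulrCA ler_peMr ?exprn_ge0 ?ler0n //.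
by rewrite mulrC ler_pdivlMr // mul1r.
Qed.

Lemma perceptron_query_size : query_size_bound R perceptron.
Proof.
(* The additive constant [c1] is absorbed because the integer q(1, ..., 1) is at least 2. *)
exists (c1 / ln 2 + c2) => n q hq n0 Q1 answer vs t r v vs_v.
have [_ _ _ /(_ v vs_v) hv] := run_unique hq r; have [_ QE] := at_onesE hq.
apply: le_trans (bits_bound hq hv) _.
have lQ : ln 2 <= ln (at_ones R q).
  by rewrite QE ltr1n in Q1; rewrite QE exp.ler_ln ?ler_nat // posrE ltr0n // ltnW.
have lQ0 := le_trans (ltW ln2_gt0) lQ.
apply: (@le_trans _ _ ((c1 / ln 2 + c2) * ln (at_ones R q))).
  by rewrite mulrDl lerD2r -mulrA ler_peMr // mulrC ler_pdivlMr // mul1r.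
rewrite ler_wpM2l ?addr_ge0 ?divr_ge0 ?(ltW ln2_gt0) //.
by rewrite ler_peMl // -[X in X <= _]sqrtr1 ler_wsqrtr // ler1n.
Qed.
End Bounds.

Theorem theorem3p2 (R : realType) :
  (forall (n : nat) (q : {mpoly R[n]}),
      S_hyperbolic q -> (problem1 q <-> problem2 q)) /\
  (exists c : com,
      [/\ poly_time R c,
          solves_problem1 R c,
          query_count_bound R c
        & query_size_bound R c]).
Proof.
split; first by move=> n q; exact: problem1_iff_problem2.
exists perceptron; split.
- exact: perceptron_poly_time.
- exact: perceptron_solves.
- exact: perceptron_query_count.
exact: perceptron_query_size.
Qed.
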